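(* Let $R(z)$ be a proper rational fraction of degree $n$ whose poles do not belong to the real axis $\mathbb R$, and let $\mu_*$ be the function associated with $R$ as in the context. Then the following $(q,p)$-inequality of Jackson-Nikolskii type holds: $$\|R\|_{L^q(\mathbb R)}\le\left(\frac{m_p}{\pi}\,\|\mu_*\|_{L^\infty(\mathbb R)}\right)^{\frac1p-\frac1q}\|R\|_{L^p(\mathbb R)},\qquad q>p>0,\qquad(1)$$ where $m_p\in\mathbb N\cap[\tfrac p2;1+\tfrac p2)$. Moreover, if all the poles of $R$ lie outside the strip $$S_\delta:=\{z:|\operatorname{Im}z|\le\delta\},\qquad \delta>0,$$ then $$\|R\|_{L^q(\mathbb R)}\le\left(\frac{m_p\,n}{\pi\delta}\right)^{\frac1p-\frac1q}\|R\|_{L^p(\mathbb R)},\qquad q>p>0.\qquad(2)$$ The inequalities (1) and (2) are sharp for $(q,p)=(\infty,2)$ and $(q,p)=(\infty,4)$.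
   Context: A proper rational fraction is a quotient $P/Q$ of polynomials with $\deg P<\deg Q$; its degree is the number of its poles counted with multiplicity. $\mathbb C^+=\{z:\operatorname{Im}z>0\}$. $\|R\|_{L^p(\mathbb R)}=\left(\int_{\mathbb R}|R(x)|^p\,dx\right)^{1/p}$ for $0<p<\infty$ and $\|R\|_{L^\infty(\mathbb R)}=\sup_{\mathbb R}|R|$; the value $q=\infty$ is admitted, with $1/\infty=0$. Given a proper rational fraction $R$ of degree $n$ without real poles, put $\mathcal R_*(z):=R(z)\cdot\overline{R(\overline z)}$. Denote by $z_k$, $k=1,\dots,\nu$, all pairwise distinct poles of the rational function $\mathcal R_*$ which lie in the half-plane $\mathbb C^+$ and by $n_k$ their multiplicities, and set $$\mu_*(x)=\sum_{k=1}^{\nu}\frac{n_k\operatorname{Im}z_k}{|x-\overline{z_k}|^2},\qquad \sum_{k=1}^{\nu}n_k=n.$$ *)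

(* Defs.v *)
From HB Require Import structures.
From mathcomp Require Import all_boot all_order all_algebra.
From mathcomp Require Import all_classical all_reals all_analysis.
From mathcomp Require Import complex.
Set Implicit Arguments.
Unset Strict Implicit.
Unset Printing Implicit Defensive.
Import Order.TTheory GRing.Theory Num.Theory.

Local Open Scope ring_scope.
Local Open Scope complex_scope.

Section RationalFractions.
Variable R : realType.
Local Notation C := R[i].

(* A quotient of two polynomials, not necessarily in lowest terms. *)
Record ratfrac := RatFrac {
  num : {poly C};
  den : {poly C};
  den_neq0 : den != 0 }.

Implicit Types f : ratfrac.

Definition rnum f : {poly C} := num f %/ gcdp (num f) (den f).
Definition rden f : {poly C} := den f %/ gcdp (num f) (den f).

(* Lowest terms are used so that removable singularities get their true
   value, instead of the value 0 given by division by 0. *)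
Definition ev f (z : C) : C := (rnum f).[z] / (rden f).[z].

Definition is_proper f : bool := (size (num f) < size (den f))%N.

Definition poles f : seq C := undup (sval (closed_field_poly_normal (rden f))).

Definition pole_mult f (z : C) : nat := mup z (rden f).

Definition degree f : nat := \sum_(z <- poles f) pole_mult f z.

Definition conj_poly (p : {poly C}) : {poly C} := map_poly (@conjc R) p.

Lemma star_den_neq0 f : den f * conj_poly (den f) != 0.
Proof. by rewrite mulf_neq0 ?map_poly_eq0 ?den_neq0. Qed.

(* z |-> f z * (f z^* )^*, since (p.[z^*])^* = (conj_poly p).[z].  Its poles
   are taken after cancellation. *)
Definition star f : ratfrac :=
  RatFrac (num f * conj_poly (num f)) (star_den_neq0 f).

Definition cabs (z : C) : R := Normc.normc z.

Definition mu_star f (x : R) : R :=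
  \sum_(z <- poles (star f) | 0 < complex.Im z)
     (pole_mult (star f) z)%:R * complex.Im z / cabs (x%:C - z^*) ^+ 2.

(* Number n_1 + ... + n_nu of poles of star f in the upper half-plane.  It is
   smaller than the degree of f when a zero of f is conjugate to a pole of f. *)
Definition star_degree f : nat :=
  \sum_(z <- poles (star f) | 0 < complex.Im z) pole_mult (star f) z.

Definition sup_norm (g : R -> R) : \bar R :=
  ereal_sup [set (`|g x|)%:E | x in [set: R]].

(* The L^q(R) norm of f on the real axis, for 0 < q <= +oo.  For q = +oo it is
   the plain supremum and not the essential one. *)
Definition normL (q : \bar R) f : \bar R :=
  match q with
  | r%:E => Lnorm (@lebesgue_measure R) r%:E (fun x => (cabs (ev f x%:C))%:E)
  | _ => sup_norm (fun x => cabs (ev f x%:C))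
  end%E.

(* 1 / q, with 1 / oo = 0. *)
Definition inv_exp (q : \bar R) : R := if q is r%:E%E then r^-1 else 0.

Definition no_real_pole f : Prop :=
  forall z, z \in poles f -> complex.Im z != 0.

Definition poles_outside_strip (delta : R) f : Prop :=
  forall z, z \in poles f -> ~~ (`|complex.Im z| <= delta).

(* m is the natural number m_p. *)
Definition is_m (p : R) (m : nat) : Prop := p / 2 <= m%:R < 1 + p / 2.

(* The right-hand sides of the two inequalities, with m_p / pi replaced by an
   arbitrary constant c. *)
Definition rhs_mu (c p : R) (q : \bar R) f : \bar R :=
  ((c%:E * sup_norm (mu_star f)) `^ (p^-1 - inv_exp q) * normL p%:E f)%E.

Definition rhs_strip (c delta p : R) (q : \bar R) f : \bar R :=
  (((c * (degree f)%:R / delta)%:E) `^ (p^-1 - inv_exp q) * normL p%:E f)%E.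

End RationalFractions.

(* Main.v *)
(* Write |f| = |P / Q| on the real line with all zeros w of Q in the lower
   half-plane: common zeros of num f and of the conjugate of den f are removed,
   then the remaining poles are reflected, which does not change the modulus.
   Then mu_star f is the sum of the |Im w| / |x - w|^2.

   For p = 2 one splits P / Q = c / (x - w) + (x - w^* ) / (x - w) P1 / Q1.  The
   two terms are orthogonal, because a fraction with all its poles in the lower
   half-plane that is O(1 / x^2) has integral 0.  Induction (this is the
   Malmquist-Takenaka basis) and Cauchy-Schwarz give
   pi |f x|^2 <= mu_star f x * int |f|^2.

   For p <= 2 m apply this to f^m, whose mu_star is m times that of f, and use
   int |f|^(2 m) <= sup |f|^(2 m - p) int |f|^p.  The case q < oo follows from
   int |f|^q <= sup |f|^(q - p) int |f|^p.

   Equality holds for p = 4 at 1 / (x + i), and for p = 2 at the reproducing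
   kernel of the space of fractions with a single pole of order n. *)

Require Import Defs.
From HB Require Import structures.
From mathcomp Require Import all_boot all_order all_algebra.
From mathcomp Require Import all_classical all_reals all_analysis.
From mathcomp Require Import measurable_realfun.
From mathcomp Require Import complex ring lra zify.
Set Implicit Arguments.
Unset Strict Implicit.
Unset Printing Implicit Defensive.
Import Order.TTheory GRing.Theory Num.Theory.
Import numFieldNormedType.Exports.
Local Open Scope ring_scope.
Local Open Scope complex_scope.
Local Open Scope classical_set_scope.

Local Notation Re := complex.Re.
Local Notation Im := complex.Im.
Local Notation num := Defs.num.
(* Overrides Num.conj, which on R[i] is convertible to conjc. *)
Local Notation "z ^*" := (conjc z) : ring_scope.

(** * Improper integrals *)

Section Integrals.
Variable R : realType.
Local Notation C := R[i].
Implicit Types (g F : R -> R) (x I : R) (n : nat).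

(* The improper integral as a symmetric limit, so that 1 / (x - w) is
   integrable. *)
Definition has_int g I := exists2 F : R -> R,
  forall x, is_derive x (1 : R) F (g x) &
  (F n.+1%:R - F (- n.+1%:R)) @[n --> \oo] --> I.

Lemma has_intD g1 g2 I1 I2 : has_int g1 I1 -> has_int g2 I2 ->
  has_int (fun x => g1 x + g2 x) (I1 + I2).
Proof.
move=> [F1 d1 l1] [F2 d2 l2]; exists (F1 \+ F2) => [x|].
  by have := d1 x; have := d2 x => ? ?; exact: is_deriveD.
have -> : (fun n => (F1 \+ F2) n.+1%:R - (F1 \+ F2) (- n.+1%:R)) =
  (fun n => (F1 n.+1%:R - F1 (- n.+1%:R)) + (F2 n.+1%:R - F2 (- n.+1%:R))).
  by apply/funext => n /=; ring.
exact: cvgD.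
Qed.

Lemma has_intZ k g I : has_int g I -> has_int (fun x => k * g x) (k * I).
Proof.
move=> [F d l]; exists (fun x => k * F x) => [x|].
  by have := d x => ?; exact: is_deriveZ.
have -> : (fun n => k * F n.+1%:R - k * F (- n.+1%:R)) =
  (fun n => k * (F n.+1%:R - F (- n.+1%:R))).
  by apply/funext => n /=; ring.
by apply: cvgMr.
Qed.

Lemma has_int_ext g1 g2 I : g1 =1 g2 -> has_int g1 I -> has_int g2 I.
Proof. by move=> /funext ->. Qed.

Lemma has_int0 : has_int (fun=> 0) 0.
Proof.
exists (fun=> 0) => [x|]; first exact: is_derive_cst.
by rewrite subrr; exact: cvg_cst.
Qed.

Lemma is_derive_continuous F g : (forall x, is_derive x (1 : R) F (g x)) ->
  continuous F.
Proof.
by move=> dF x; apply/differentiable_continuous/derivable1_diffP; case: (dF x).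
Qed.

(** Monotone convergence over the intervals [-(n+1), n+1] turns the Lebesgue integral into a limit,
    and the fundamental theorem of calculus evaluates each term. Nonnegativity makes the symmetric
    limit the true integral. *)
Lemma has_int_integral g I : (forall x, 0 <= g x) -> continuous g ->
  has_int g I -> (\int[@lebesgue_measure R]_x (g x)%:E = I%:E)%E.
Proof.
move=> g0 cg [F dF lF].
have UT : \bigcup_n `[(- n.+1%:R : R), n.+1%:R]%classic = [set: R].
  apply/seteqP; split=> // x _; exists (Num.truncn `|x|) => //=.
  by rewrite in_itv /= -ler_norml ltW// truncnS_gt.
rewrite -UT.
have -> := esym (cvg_lim (@ereal_hausdorff R)
  (@ge0_nondecreasing_set_cvg_integral _ (measurableTypeR R) R
  (fun n => `[(- n.+1%:R : R), n.+1%:R]%classic) (EFin \o g) (@lebesgue_measure R)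
  _ _ _ _)); last first.
- by move=> i x _; rewrite /= lee_fin.
- move=> i; apply/measurable_EFinP/(measurable_funS measurableT) => //.
  exact: continuous_measurable_fun.
- by move=> i; exact: measurable_itv.
- move=> m n mn; apply/subsetPset => x /=; rewrite !in_itv /= => /andP[h1 h2].
  by rewrite (le_trans _ h1) ?(le_trans h2)// ?lerN2 ler_nat.
apply/cvg_lim => //.
rewrite (_ : (fun i => _) = EFin \o (fun n => F n.+1%:R - F (- n.+1%:R))).
  by apply: cvg_EFin => //; exact: nearW.
apply/funext => n /=; rewrite EFinB; apply: continuous_FTC2.
- by rewrite gtrN.
- exact: continuous_subspaceT.
- split=> [x _||]; first by case: (dF x).
    by apply: cvg_at_right_filter; exact: (is_derive_continuous dF).
  by apply: cvg_at_left_filter; exact: (is_derive_continuous dF).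
- by move=> x _; rewrite derive1E; case: (dF x).
Qed.
End Integrals.

(** * Derivatives of complex-valued functions of a real variable *)

Section ComplexDerivative.
Variable R : realType.
Local Notation C := R[i].
Implicit Types (x y : R) (w c d : C) (g h : R -> C).

Lemma cRe_add c d : Re (c + d) = Re c + Re d.
Proof. by case: c d => a b [a' b']. Qed.

Lemma cRe_mul c d : Re (c * d) = Re c * Re d - Im c * Im d.
Proof. by case: c d => a b [a' b']. Qed.

Lemma cIm_Re c : Im c = Re (- 'i * c).
Proof. by case: c => a b /=; ring. Qed.

Lemma real_sub_neq0 x w : Im w != 0 -> x%:C - w != 0.
Proof. by apply: contraNneq => /subr0_eq <-. Qed.

Lemma inv_XsubC (a b y : R) : (y%:C - (a +i* b))^-1 =
  ((y - a) / ((y - a) ^+ 2 + b ^+ 2)) +i* (b / ((y - a) ^+ 2 + b ^+ 2)).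
Proof.
have -> : y%:C - (a +i* b) = (y - a) +i* (- b) by simpc.
by rewrite /GRing.inv /= sqrrN mulNr opprK.
Qed.

(** The derivative is tested against the real functionals Re (c * _): [c = 1] and [c = - 'i] give
    the real and imaginary parts, and the quantifier over [c] makes complex scalar factors free. *)
Definition is_deriveC g x d :=
  forall c, is_derive x (1 : R) (fun y => Re (c * g y)) (Re (c * d)).

Lemma is_deriveCM g h x dg dh : is_deriveC g x dg -> is_deriveC h x dh ->
  is_deriveC (fun y => g y * h y) x (g x * dh + dg * h x).
Proof.
move=> Dg Dh c.
have H1 := Dg c; have H2 := Dg (- 'i * c); have H3 := Dh 1; have H4 := Dh (- 'i).
have -> : (fun y => Re (c * (g y * h y))) =
  ((fun y => Re (c * g y)) * (fun y => Re (1 * h y))) -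
  ((fun y => Re (- 'i * c * g y)) * (fun y => Re (- 'i * h y))).
  apply/funext => y; rewrite !fctE.
  by rewrite mulrA cRe_mul mul1r !cIm_Re mulrA.
apply: is_derive_eq.
rewrite /GRing.scale /= !mul1r; move: (g x) (h x); move: c dg dh {H1 H2 H3 H4 Dg Dh}
  => [c1 c2] [dg1 dg2] [dh1 dh2] [g1 g2] [h1 h2] /=; ring.
Qed.

Lemma is_deriveC_pole w x : Im w != 0 ->
  is_deriveC (fun y => (y%:C - w)^-1) x (- (x%:C - w) ^- 2).
Proof.
case: w => a b /= b0 [c1 c2].
have q0 y : (y - a) ^+ 2 + b ^+ 2 != 0.
  by rewrite lt0r_neq0// ltr_wpDl ?sqr_ge0// exprn_even_gt0.
have -> : (fun y => Re ((c1 +i* c2) * (y%:C - (a +i* b))^-1)) =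
  (fun y => (c1 * (y - a) - c2 * b) * ((y - a) ^+ 2 + b ^+ 2)^-1).
  by apply/funext => y; rewrite inv_XsubC /=; ring.
have D1 : is_derive x (1 : R) (fun y => c1 * (y - a) - c2 * b) c1.
  have -> : (fun y => c1 * (y - a) - c2 * b) = ((c1 \*: (id - cst a)) - cst (c2 * b)).
    by [].
  by apply: is_derive_eq; rewrite /GRing.scale /=; ring.
have D2 : is_derive x (1 : R) (fun y => (y - a) ^+ 2 + b ^+ 2) (2 * (x - a)).
  have -> : (fun y => (y - a) ^+ 2 + b ^+ 2) = ((id - cst a) ^+ 2 + cst (b ^+ 2)).
    by [].
  by apply: is_derive_eq; rewrite /GRing.scale /= !fctE; ring.
have D3 := @is_deriveV R (fun y => (y - a) ^+ 2 + b ^+ 2) _ _ _ (q0 x) D2.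
have D4 := is_deriveM D1 D3.
apply: (is_derive_eq D4).
have -> : - (x%:C - (a +i* b)) ^- 2 = - ((x%:C - (a +i* b))^-1 * (x%:C - (a +i* b))^-1).
  by rewrite expr2 invfM.
rewrite inv_XsubC /GRing.scale /=; field.
exact: q0.
Qed.

Lemma is_deriveC_poleX w x n : Im w != 0 ->
  is_deriveC (fun y => (y%:C - w) ^- n) x (- n%:R * (x%:C - w) ^- n.+1).
Proof.
move=> w0; elim: n => [c|n IH].
  rewrite mulNr mul0r oppr0 mulr0.
  have -> : (fun y : R => Re (c * (y%:C - w) ^- 0)) = cst (Re c).
    by apply/funext => y /=; rewrite expr0 invr1 mulr1.
  exact: is_derive_cst.
have -> : (fun y : R => (y%:C - w) ^- n.+1) =
   (fun y : R => (y%:C - w) ^- n * (y%:C - w)^-1).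
  by apply/funext => y; rewrite exprSr invfM mulrC.
have := is_deriveCM IH (is_deriveC_pole x w0).
congr is_deriveC.
rewrite -!exprVn -natr1 !exprSr; ring.
Qed.

End ComplexDerivative.

(** * Integrals of negative powers of x - w over the real line *)

Section PoleIntegrals.
Variable R : realType.
Local Notation C := R[i].
Implicit Types (a b x y : R) (w c d : C) (g h : R -> C).

Lemma cvgn_atan a b : 0 < b ->
  atan ((n.+1%:R - a) / b) @[n --> \oo] --> (pi / 2 : R).
Proof.
move=> b0; apply: (@cvg_comp _ _ _ (fun n : nat => (n.+1%:R - a) / b) (@atan R));
  last exact: cvgy_atan.
apply/cvgryPge => A; near=> n.
rewrite ler_pdivlMr// lerBrDr.
have : A * b + a <= n%:R by near: n; exact: nbhs_infty_ger.
by move/le_trans; apply; rewrite ler_nat.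
Unshelve. all: by end_near.
Qed.

Lemma sqr_add_sqr_gt0 x b : b != 0 -> 0 < x ^+ 2 + b ^+ 2.
Proof. by move=> b0; rewrite ltr_wpDl ?sqr_ge0// exprn_even_gt0. Qed.

(** After division by (n+1)^2 the quotient of the two arguments is a continuous function [phi] of t
    = 1 / (n+1), with value 1 at t = 0. *)
Lemma cvgn_ln_ratio a b : b != 0 ->
  (ln ((n.+1%:R - a) ^+ 2 + b ^+ 2) - ln ((- n.+1%:R - a) ^+ 2 + b ^+ 2))
    @[n --> \oo] --> (0 : R).
Proof.
move=> b0.
pose phi t := ((1 - a * t) ^+ 2 + (b * t) ^+ 2) / ((1 + a * t) ^+ 2 + (b * t) ^+ 2) : R.
have -> : (fun n : nat => ln ((n.+1%:R - a) ^+ 2 + b ^+ 2) -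
    ln ((- n.+1%:R - a) ^+ 2 + b ^+ 2)) = ((@ln R) \o phi) \o harmonic.
  apply/funext => n /=; rewrite -ln_div ?posrE ?sqr_add_sqr_gt0//.
  congr ln; rewrite /phi; field.
  by rewrite nat1r pnatr_eq0 /= lt0r_neq0// sqr_add_sqr_gt0.
have hp (k : R) : continuous (fun t : R => (1 + k * t) ^+ 2 + (b * t) ^+ 2 : R).
  have -> : (fun t => (1 + k * t) ^+ 2 + (b * t) ^+ 2 : R) =
      horner ((1 + k *: 'X) ^+ 2 + (b *: 'X) ^+ 2).
    by apply/funext => t; rewrite !hornerE.
  exact: continuous_horner.
have p0 : phi 0 = 1.
  by rewrite /phi !mulr0 subr0 addr0 expr0n /= expr1n addr0 invr1 mulr1.
have c0 : {for 0, continuous ((@ln R) \o phi)}.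
  apply: continuous_comp; last by rewrite p0; apply: continuous_ln.
  apply: cvgM.
    by have := hp (- a) 0; under eq_fun do rewrite mulNr; exact.
  apply: cvgV; last exact: hp.
  by rewrite !mulr0 addr0 expr0n /= expr1n addr0 oner_neq0.
have := cvg_comp _ _ (@cvg_harmonic R) c0.
by rewrite /= p0 ln1.
Qed.

Definition has_intC g d := forall c, has_int (fun x => Re (c * g x)) (Re (c * d)).

Lemma has_intC_ext g1 g2 d : g1 =1 g2 -> has_intC g1 d -> has_intC g2 d.
Proof. by move=> /funext ->. Qed.

Lemma has_intCD g1 g2 d1 d2 : has_intC g1 d1 -> has_intC g2 d2 ->
  has_intC (fun x => g1 x + g2 x) (d1 + d2).
Proof.
move=> h1 h2 c; rewrite mulrDr cRe_add.
apply: has_int_ext (has_intD (h1 c) (h2 c)) => x /=.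
by rewrite mulrDr cRe_add.
Qed.

Lemma has_intCZ k g d : has_intC g d -> has_intC (fun x => k * g x) (k * d).
Proof.
move=> h c; rewrite mulrA; apply: has_int_ext (h (c * k)) => x /=.
by rewrite mulrA.
Qed.

(** The antiderivative has a logarithmic part, which cancels in the symmetric limit, and an
    arctangent part, which increases by pi in total. The sign of the result comes from [w] lying
    below the axis. *)
Lemma has_intC_pole w : Im w < 0 ->
  has_intC (fun x => (x%:C - w)^-1) (0 -i* pi).
Proof.
case: w => a b b0 [c1 c2]; rewrite /= in b0.
have bn0 : b != 0 by rewrite lt_eqF.
have bN0 : 0 < - b by rewrite oppr_gt0.
pose q x := (x - a) ^+ 2 + b ^+ 2.
exists (fun x => c1 / 2 * ln (q x) + c2 * atan ((x - a) / - b)) => [x|].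
  have D1 : is_derive x (1 : R) q (2 * (x - a)).
    have -> : q = ((id - cst a) ^+ 2 + cst (b ^+ 2)) by [].
    by apply: is_derive_eq; rewrite /GRing.scale /= !fctE; ring.
  have D2 : is_derive x (1 : R) (fun y => (y - a) / - b) (- b)^-1.
    have -> : (fun y => (y - a) / - b) = ((- b)^-1 \*: (id - cst a)).
      by apply/funext => y; rewrite mulrC.
    by apply: is_derive_eq; rewrite /GRing.scale /=; ring.
  have q0 : 0 < q x by exact: sqr_add_sqr_gt0.
  have D3 := is_derive1_comp (is_derive1_ln q0) D1.
  have D4 := @is_derive1_comp R _ (fun y => (y - a) / - b) _ _ _ (is_derive1_atan _) D2.
  have D5 := is_deriveD (is_deriveZ (c1 / 2) D3) (is_deriveZ c2 D4).
  apply: (is_derive_eq D5); rewrite inv_XsubC /GRing.scale /= /q; field.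
  by rewrite bn0 lt0r_neq0//; exact: q0.
have -> : (fun n : nat =>
    c1 / 2 * ln (q n.+1%:R) + c2 * atan ((n.+1%:R - a) / - b)
    - (c1 / 2 * ln (q (- n.+1%:R)) + c2 * atan ((- n.+1%:R - a) / - b))) =
  (fun n : nat => c1 / 2 * (ln (q n.+1%:R) - ln (q (- n.+1%:R))) +
    c2 * (atan ((n.+1%:R - a) / - b) + atan ((n.+1%:R - - a) / - b))).
  apply/funext => n; have -> : (- n.+1%:R - a) / - b = - ((n.+1%:R - - a) / - b).
    by field.
  by rewrite atanN; ring.
have -> : Re ((c1 +i* c2) * (0 -i* pi)) = c1 / 2 * 0 + c2 * (pi / 2 + pi / 2).
  by rewrite /=; field.
apply: cvgD; apply: cvgMr; first exact: cvgn_ln_ratio.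
by apply: cvgD; exact: cvgn_atan.
Qed.

(** The factor [e] is there to treat both ends of the line at once, with values 1 and -1. *)
Lemma cvgn_pole w (e : R) : Im w != 0 -> e != 0 ->
  (fun n : nat => Re ((e * n.+1%:R)%:C - w)^-1) @ \oo --> (0 : R) /\
  (fun n : nat => Im ((e * n.+1%:R)%:C - w)^-1) @ \oo --> (0 : R).
Proof.
case: w => a b b0 e0; rewrite /= in b0.
have hp (k l : R) : continuous (fun t : R => (k - l * t) ^+ 2 + (b * t) ^+ 2).
  have -> : (fun t => (k - l * t) ^+ 2 + (b * t) ^+ 2 : R) =
      horner ((k%:P - l *: 'X) ^+ 2 + (b *: 'X) ^+ 2).
    by apply/funext => t; rewrite !hornerE.
  exact: continuous_horner.
have hv : {for 0, continuous (fun t => ((e - a * t) ^+ 2 + (b * t) ^+ 2)^-1)}.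
  apply: cvgV; last exact: hp.
  by rewrite !mulr0 subr0 expr0n /= addr0 expf_neq0.
have q0 (n : nat) : (e * n.+1%:R - a) ^+ 2 + b ^+ 2 != 0.
  by rewrite lt0r_neq0// sqr_add_sqr_gt0.
have lin (k l : R) : continuous (fun t : R => k * t + l * t ^+ 2).
  have -> : (fun t : R => k * t + l * t ^+ 2) = horner (k *: 'X + l *: 'X ^+ 2).
    by apply/funext => t; rewrite !hornerE.
  exact: continuous_horner.
(* Both parts have this form in t = 1 / (n+1), which is continuous at t = 0 and vanishes there. *)
have key (k l : R) (u : nat -> R) :
    (forall n, u n = (k * harmonic n + l * harmonic n ^+ 2) *
       ((e - a * harmonic n) ^+ 2 + (b * harmonic n) ^+ 2)^-1) ->
    u @ \oo --> (0 : R).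
  move=> uE.
  pose v t := (k * t + l * t ^+ 2) * ((e - a * t) ^+ 2 + (b * t) ^+ 2)^-1.
  have -> : u = v \o harmonic by apply/funext => n; rewrite uE.
  have c0 : {for 0, continuous v}.
    by apply: cvgM => //; exact: lin.
  have := cvg_comp _ _ (@cvg_harmonic R) c0.
  by rewrite /= /v !(mulr0, expr0n, mul0r, addr0).
split; [apply: (key e (- a))|apply: (key 0 b)] => n; rewrite inv_XsubC /=; field.
- by rewrite nat1r pnatr_eq0 /= q0.
- by rewrite nat1r pnatr_eq0 /= q0.
Qed.

Lemma cvgn_poleX w (e : R) m c : Im w != 0 -> e != 0 ->
  (fun n : nat => Re (c * ((e * n.+1%:R)%:C - w) ^- m.+1)) @ \oo --> (0 : R).
Proof.
move=> w0 e0; have [lr li] := cvgn_pole w0 e0.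
elim: m c => [|m IH] c.
  under eq_fun do rewrite expr1 cRe_mul.
  rewrite -(subrr (0 : R)) -[X in X - _](mulr0 (Re c)) -[X in _ - X](mulr0 (Im c)).
  by apply: cvgB; apply: cvgMr.
under eq_fun do rewrite exprSr invfM mulrA cRe_mul (cIm_Re (c * _)) mulrA.
rewrite -(subrr (0 : R)) -[X in X - _](mulr0 (0 : R)) -[X in _ - X](mulr0 (0 : R)).
apply: cvgB; apply: cvgM => //.
Qed.

(** For exponents at least 2 the antiderivative is again a negative power of x - w, hence tends to 0
    at both ends. *)
Lemma has_intC_poleX w m : Im w < 0 ->
  has_intC (fun x => (x%:C - w) ^- m.+2) 0.
Proof.
move=> w0 c; have w1 : Im w != 0 by rewrite lt_eqF.
pose F x := Re (- (m.+1%:R^-1 * c) * (x%:C - w) ^- m.+1).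
exists F => [x|].
  have := is_deriveC_poleX x m.+1 w1 (- (m.+1%:R^-1 * c)); congr is_derive.
  by rewrite !mulNr mulrN opprK mulrACA mulVf ?pnatr_eq0// mul1r.
have lim (e : R) : e != 0 -> F (e * n.+1%:R) @[n --> \oo] --> (0 : R).
  by move=> e0; exact: cvgn_poleX.
have -> : Re (c * 0) = 0 - 0 by rewrite mulr0 subrr.
apply: cvgB.
  by have := lim 1 (oner_neq0 _); under eq_fun do rewrite mul1r; exact.
have : (-1 : R) != 0 by rewrite oppr_eq0 oner_neq0.
by move/lim; under eq_fun do rewrite mulN1r; exact.
Qed.

End PoleIntegrals.

(** * Fractions with poles in the lower half-plane *)

Section LowerPoles.
Variable R : realType.
Local Notation C := R[i].
Implicit Types (x y : R) (w c d : C) (ws : seq C) (P : {poly C}).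

(** Poles are listed with repetition, so that the arguments on fractions are inductions removing one
    pole at a time. *)
Definition poly_of_roots ws : {poly C} := \prod_(w <- ws) ('X - w%:P).

Definition pfrac P ws x : C := P.[x%:C] / (poly_of_roots ws).[x%:C].

Definition lower_half w := Im w < 0.

Lemma horner_roots_cons w ws z :
  (poly_of_roots (w :: ws)).[z] = (z - w) * (poly_of_roots ws).[z].
Proof. by rewrite /poly_of_roots big_cons hornerM hornerXsubC. Qed.

Lemma horner_roots_neq0 ws z : all lower_half ws -> 0 <= Im z ->
  (poly_of_roots ws).[z] != 0.
Proof.
move=> lws z0; rewrite -rootE root_prod_XsubC; apply/negP => /(allP lws).
by rewrite /lower_half ltNge z0.
Qed.

Lemma size_poly_of_roots ws : size (poly_of_roots ws) = (size ws).+1.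
Proof. exact: size_prod_XsubC. Qed.

Lemma poly_XsubC_divP P w (n : nat) : (size P <= n.+1)%N -> exists2 P1 : {poly C},
  P = P.[w]%:P + ('X - w%:P) * P1 & (size P1 <= n)%N.
Proof.
move=> sP.
have /factor_theorem[P1 PE] : root (P - P.[w]%:P) w.
  by rewrite rootE !hornerE subrr.
exists P1; first by rewrite mulrC -PE addrC subrK.
have [->|P10] := eqVneq P1 0; first by rewrite size_poly0.
have := size_polyD P (- (P.[w])%:P); rewrite PE size_Mmonic ?monicXsubC//.
rewrite size_XsubC addn2 /= size_polyN -(ltnS (size P1)).
move=> /leq_trans; apply.
by rewrite geq_max sP (leq_trans (size_polyC_leq1 _)).
Qed.

(** This replaces the residue theorem. If all poles coincide, 1 / Q is a negative power of x - w.
    Otherwise two distinct poles are separated by partial fractions, which leaves a difference of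
    two fractions with one pole fewer. *)
Lemma has_intC_inv_poly ws (n : nat) : size ws = n.+1 -> all lower_half ws ->
  has_intC (pfrac 1 ws) ((n == 0)%:R * (0 -i* pi)).
Proof.
elim: n ws => [|n IH] [|w ws]//= [sws] /andP[lw lws].
  move/size0nil: sws => ->; rewrite mul1r.
  apply: has_intC_ext (has_intC_pole lw) => x.
  by rewrite /pfrac /poly_of_roots big_seq1 hornerC hornerXsubC mul1r.
rewrite mul0r; have [/all_pred1P wsE|] := boolP (all (pred1 w) ws).
  apply: has_intC_ext (has_intC_poleX n lw) => x.
  rewrite /pfrac horner_roots_cons wsE sws /poly_of_roots big_nseq hornerC mul1r.
  by rewrite (_ : iter _ _ _ = ('X - w%:P) ^+ n.+1) ?iter_mulr_1//
    horner_exp hornerXsubC exprS.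
rewrite -has_predC => /hasP[w' w'ws /= w'w].
pose s := rem w' ws.
have wsE : perm_eq ws (w' :: s) by exact: perm_to_rem.
have ss : (size s).+1 = n.+1 by rewrite -sws (perm_size wsE).
have /andP[lw' ls] : all lower_half (w' :: s) by rewrite -(perm_all _ wsE).
have h1 : all lower_half (w :: s) by apply/andP.
have h2 : all lower_half (w' :: s) by apply/andP.
(* Both integrals have the same value by induction, even when only one pole is left in each, so
   their difference is 0. *)
have := has_intCZ (w - w')^-1
  (has_intCD (IH (w :: s) ss h1) (has_intCZ (-1) (IH (w' :: s) ss h2))).
rewrite mulN1r subrr mulr0; apply: has_intC_ext => x.
have n0 v : lower_half v -> x%:C - v != 0.
  by move=> lv; rewrite real_sub_neq0// lt_eqF.
have wsQ : poly_of_roots ws = poly_of_roots (w' :: s) by exact: perm_big.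
rewrite /pfrac horner_roots_cons [in RHS]horner_roots_cons wsQ !horner_roots_cons hornerC.
have q0 : (poly_of_roots s).[x%:C] != 0 by exact: horner_roots_neq0.
have := n0 w lw; have := n0 w' lw'.
move: (poly_of_roots s).[_] q0 => q q0 n1 n2.
by field; rewrite q0 n1 n2 subr_eq0 eq_sym w'w.
Qed.

(** Dividing [P] by X - w splits off a constant over Q, whose integral is 0 when there are at least
    two poles, and leaves a fraction with one pole fewer. Only the behaviour at infinity matters:
    the integral vanishes as soon as the fraction is O(1 / x^2). *)
Lemma has_intC_pfrac ws P (n : nat) : size ws = n.+1 -> all lower_half ws ->
  (size P <= n.+1)%N -> has_intC (pfrac P ws) (P`_n * (0 -i* pi)).
Proof.
elim: n ws P => [|n IH] [|w ws] P//= [sws] /andP[lw lws] sP.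
  have -> : P = P`_0 *: 1 by rewrite (size1_polyC sP) coefC /= alg_polyC.
  have := has_intCZ P`_0 (@has_intC_inv_poly (w :: ws) 0%N _ _).
  rewrite /= sws lw lws coefZ coef1 mulr1 mul1r => /(_ erefl isT).
  by apply: has_intC_ext => x; rewrite /pfrac hornerZ mulrA.
have [P1 PE sP1] := poly_XsubC_divP w sP.
have sw : size (w :: ws) = n.+2 by rewrite /= sws.
have lw' : all lower_half (w :: ws) by rewrite /= lw.
have := has_intCD (has_intCZ P.[w] (has_intC_inv_poly sw lw')) (IH _ _ sws lws sP1).
rewrite mul0r mulr0 add0r.
have -> : P1`_n = P`_n.+1.
  rewrite PE coefD coefC /= add0r mulrBl coefB coefXM coefCM /=.
  by rewrite [X in _ - _ * X]nth_default// mulr0 subr0.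
apply: has_intC_ext => x.
have n0 : x%:C - w != 0 by rewrite real_sub_neq0// lt_eqF.
have q0 : (poly_of_roots ws).[x%:C] != 0 by exact: horner_roots_neq0.
rewrite [in RHS]PE /pfrac horner_roots_cons !hornerE.
by move: (poly_of_roots ws).[_] q0 => q q0 /=; field; rewrite q0 n0.
Qed.

End LowerPoles.
Arguments lower_half {R} w.

(** * Orthogonal splitting of a fraction at one pole *)

Section Malmquist.
Variable R : realType.
Local Notation C := R[i].
Implicit Types (x y : R) (w c d z : C) (ws : seq C) (P : {poly C}).

Lemma cabs_ge0 z : 0 <= cabs z.
Proof. by case: z => a b; exact: sqrtr_ge0. Qed.

Lemma cabsM c d : cabs (c * d) = cabs c * cabs d.
Proof. exact: Normc.normcM. Qed.

Lemma cabsV z : cabs z^-1 = (cabs z)^-1.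
Proof. exact: Normc.normcV. Qed.

Lemma cabsD c d : cabs (c + d) <= cabs c + cabs d.
Proof. exact: le_normcD. Qed.

Lemma cabs0 : cabs (0 : C) = 0.
Proof. exact: Normc.normc0. Qed.

Lemma cabs_eq0 z : (cabs z == 0) = (z == 0).
Proof.
by apply/eqP/eqP => [/Normc.eq0_normc//|->]; exact: cabs0.
Qed.

Lemma cabs_gt0 z : (0 < cabs z) = (z != 0).
Proof. by rewrite lt0r cabs_ge0 cabs_eq0 andbT. Qed.

Lemma cabs_conj z : cabs z^* = cabs z.
Proof. by case: z => a b; rewrite /cabs /= sqrrN. Qed.

Lemma cabs_sqr z : cabs z ^+ 2 = Re z ^+ 2 + Im z ^+ 2.
Proof. by case: z => a b; rewrite /cabs /= sqr_sqrtr// addr_ge0// sqr_ge0. Qed.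

Lemma cabsX z (n : nat) : cabs (z ^+ n) = cabs z ^+ n.
Proof.
elim: n => [|n IH]; first by rewrite !expr0; exact: Normc.normc1.
by rewrite !exprS cabsM IH.
Qed.

Lemma cabs_XsubC_conj x w : cabs (x%:C - w^*) = cabs (x%:C - w).
Proof. by rewrite -cabs_conj rmorphB /= conjcK oppr0. Qed.

Lemma cabs_sqrD c d :
  cabs (c + d) ^+ 2 = cabs c ^+ 2 + cabs d ^+ 2 + 2 * Re (c^* * d).
Proof. by rewrite !cabs_sqr; case: c d => a b [a' b'] /=; ring. Qed.

(** Each term is pi times a Poisson kernel of the half-plane; the absolute value makes the sum
    insensitive to reflecting poles in the real axis. *)
Definition poisson_sum ws x := \sum_(w <- ws) `|Im w| / cabs (x%:C - w) ^+ 2.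

Lemma poisson_sum_ge0 ws x : 0 <= poisson_sum ws x.
Proof. by apply: sumr_ge0 => w _; rewrite divr_ge0// sqr_ge0. Qed.

(** On the real line |x - w|^-2 is the imaginary part of 1 / (x - w) divided by that of [w]. *)
Lemma has_int_pole_sqr w : Im w < 0 ->
  has_int (fun x => cabs (x%:C - w)^-1 ^+ 2) (pi / `|Im w|).
Proof.
move=> w0.
have -> : pi / `|Im w| = (Im w)^-1 * Re (- 'i * (0 -i* pi)).
  by rewrite ltr0_norm//= invrN; ring.
apply: has_int_ext (has_intZ (Im w)^-1 (has_intC_pole w0 (- 'i))) => x /=.
rewrite -cIm_Re cabs_sqr; case: w w0 => a b b0; rewrite inv_XsubC /=.
rewrite /= in b0; have bn0 : b != 0 by rewrite lt_eqF.
by field; rewrite bn0 lt0r_neq0// sqr_add_sqr_gt0.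
Qed.

(* The two terms are orthogonal: their inner product is the integral of the
   fraction conj(c) P1 / Q, whose poles are all in the lower half-plane. *)
Lemma has_int_pfrac_cons w ws c P1 (I1 : R) : all lower_half (w :: ws) ->
  (size P1 <= size ws)%N ->
  has_int (fun x => cabs (pfrac P1 ws x) ^+ 2) I1 ->
  has_int (fun x => cabs (pfrac (c *: poly_of_roots ws + ('X - (w^*)%:P) * P1)
                               (w :: ws) x) ^+ 2)
          (cabs c ^+ 2 * (pi / `|Im w|) + I1).
Proof.
move=> lws sP1 hI1; have /andP[lw lws'] := lws.
(* The size bound kills the coefficient of [P1] of index [size ws], so the cross term integrates to
   0. *)
have h2 := has_intC_pfrac (erefl (size (w :: ws))) lws (leqW sP1).
rewrite nth_default// mul0r in h2.
have h3 := has_intZ 2 (h2 c^*); rewrite mulr0 in h3.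
have h1 := has_intZ (cabs c ^+ 2) (has_int_pole_sqr lw).
have := has_intD (has_intD h1 hI1) h3; rewrite mulr0 addr0.
apply: has_int_ext => x.
have q0 : (poly_of_roots ws).[x%:C] != 0 by exact: horner_roots_neq0.
have n0 : x%:C - w != 0 by rewrite real_sub_neq0// lt_eqF.
have n1 : x%:C - w^* != 0 by rewrite -cabs_eq0 cabs_XsubC_conj cabs_eq0.
have -> : pfrac (c *: poly_of_roots ws + ('X - (w^*)%:P) * P1) (w :: ws) x =
  c * (x%:C - w)^-1 + (x%:C - w^*) / (x%:C - w) * pfrac P1 ws x.
  rewrite /pfrac horner_roots_cons !hornerE /=.
  by move: (_.[_]) q0 => q q0; field; rewrite q0 n0.
have cx : (x%:C - w)^* = x%:C - w^* by rewrite rmorphB /= oppr0.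
rewrite cabs_sqrD !cabsM cabsV cabs_XsubC_conj divff ?cabs_eq0// mul1r.
congr (_ + _ * Re _); first by rewrite [in RHS]exprMn.
have -> : (c / (x%:C - w))^* = c^* / (x%:C - w^*).
  by rewrite -cx -conjc_inv -rmorphM.
rewrite /pfrac horner_roots_cons.
by move: (_.[_]) q0 => q q0; field; rewrite q0 n0 n1.
Qed.

End Malmquist.

(** * Pointwise bound by the L^2 norm *)

Section PointwiseBound.
Variable R : realType.
Local Notation C := R[i].
Implicit Types (x y : R) (w c d z : C) (ws : seq C) (P : {poly C}).

(** This is Cauchy-Schwarz for two terms, the pole being removed and the remaining fraction. It is
    used with k = pi, s = |c|, A = 1 / |x - w|, B = |Im w|, t the modulus of the remaining fraction
    at x, and [m1], [I1] its Poisson sum and integral. *)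
Lemma cauchy_schwarz_step (k s A t B m1 I1 : R) : 0 < B -> 0 <= I1 ->
  0 <= m1 -> 0 <= s -> 0 <= A -> 0 <= t -> 0 <= k ->
  k * t ^+ 2 <= m1 * I1 ->
  k * (s * A + t) ^+ 2 <= (B * A ^+ 2 + m1) * (s ^+ 2 * (k / B) + I1).
Proof.
move=> B0 I10 m10 s0 A0 t0 k0 kt; have B1 := ltW B0.
pose X := B * A ^+ 2 * I1; pose Y := m1 * (s ^+ 2 * (k / B)).
have X0 : 0 <= X by rewrite !mulr_ge0 ?sqr_ge0.
have Y0 : 0 <= Y by rewrite !mulr_ge0 ?sqr_ge0 ?invr_ge0.
have XY : (k * s * A * t) ^+ 2 <= X * Y.
  have -> : X * Y = k * s ^+ 2 * A ^+ 2 * (m1 * I1).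
    by rewrite /X /Y; field; rewrite gt_eqF.
  have -> : (k * s * A * t) ^+ 2 = k * s ^+ 2 * A ^+ 2 * (k * t ^+ 2) by ring.
  by apply: ler_wpM2l => //; rewrite !mulr_ge0 ?sqr_ge0.
(* By the inequality of arithmetic and geometric means, since 4 X Y <= (X + Y)^2. *)
have h : 2 * (k * s * A * t) <= X + Y.
  rewrite -ler_sqr ?nnegrE; last 2 first.
  - by rewrite !mulr_ge0.
  - exact: addr_ge0.
  have := sqr_ge0 (X - Y); nra.
have E1 : (B * A ^+ 2 + m1) * (s ^+ 2 * (k / B) + I1) =
  k * (s * A) ^+ 2 + m1 * I1 + (X + Y).
  by rewrite /X /Y; field; rewrite gt_eqF.
have E2 : k * (s * A + t) ^+ 2 = k * (s * A) ^+ 2 + k * t ^+ 2 + 2 * (k * s * A * t).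
  by ring.
by rewrite E1 E2 !lerD.
Qed.

(** Induction on the poles: the orthogonal splitting adds up the integrals and [cauchy_schwarz_step]
    combines the pointwise bounds. The uniform bound [M] later makes the supremum of the modulus
    finite. *)
Lemma pfrac_bound ws P : all lower_half ws -> (size P <= size ws)%N ->
  exists2 I, [/\ 0 <= I, has_int (fun x => cabs (pfrac P ws x) ^+ 2) I &
    forall x, pi * cabs (pfrac P ws x) ^+ 2 <= poisson_sum ws x * I] &
  exists M, forall x, cabs (pfrac P ws x) <= M.
Proof.
elim: ws P => [|w ws IH] P.
  rewrite leqn0 size_poly_eq0 => _ /eqP ->.
  have z x : cabs (pfrac (0 : {poly C}) [::] x) = 0.
    by rewrite /pfrac horner0 mul0r cabs0.
  exists 0; last by exists 0 => x; rewrite z.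
  split=> // [|x]; last by rewrite z expr0n mulr0 mulr0.
  by apply: has_int_ext (@has_int0 R) => x; rewrite z expr0n.
move=> lws sP; have /andP[lw lws'] := lws.
have qw : (poly_of_roots ws).[w^*] != 0.
  apply: horner_roots_neq0 => //; case: (w) lw => a b.
  by rewrite /lower_half /= oppr_ge0 => /ltW.
(* This [c] makes P - c Q vanish at the conjugate of [w], where Q is the product over the remaining
   poles; Q is nonzero there because its roots lie in the lower half-plane. *)
pose c := P.[w^*] / (poly_of_roots ws).[w^*].
have [|P1 PE sP1] := @poly_XsubC_divP R (P - c *: poly_of_roots ws) (w^*) (size ws).
  rewrite (leq_trans (size_polyD _ _))// size_polyN geq_max sP.
  by rewrite (leq_trans (size_scale_leq _ _))// size_poly_of_roots.
have {}PE : P = c *: poly_of_roots ws + ('X - (w^*)%:P) * P1.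
  move/eqP: PE; rewrite subr_eq => /eqP ->.
  by rewrite !hornerE divfK// subrr add0r addrC.
have [I1 [I10 hI1 b1] [M1 hM1]] := IH P1 lws' sP1.
have n0 x : x%:C - w != 0 by rewrite real_sub_neq0// lt_eqF.
have GE x : cabs (pfrac P (w :: ws) x) <=
    cabs c * cabs (x%:C - w)^-1 + cabs (pfrac P1 ws x).
  have q0 : (poly_of_roots ws).[x%:C] != 0 by exact: horner_roots_neq0.
  have -> : pfrac P (w :: ws) x =
    c * (x%:C - w)^-1 + (x%:C - w^*) / (x%:C - w) * pfrac P1 ws x.
    rewrite PE /pfrac horner_roots_cons !hornerE /=.
    by have := n0 x; move: (_.[_]) q0 => q q0 n1; field; rewrite q0 n1.
  apply: le_trans (cabsD _ _) _; rewrite !cabsM cabs_XsubC_conj.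
  by rewrite !cabsV divff ?mul1r// cabs_eq0.
have w1 : 0 < `|Im w| by rewrite normr_gt0 lt_eqF.
exists (cabs c ^+ 2 * (pi / `|Im w|) + I1).
  split=> [||x]; first by rewrite addr_ge0// mulr_ge0 ?sqr_ge0// divr_ge0// pi_ge0.
    by rewrite PE; exact: has_int_pfrac_cons.
  apply: le_trans (_ : pi * (cabs c * cabs (x%:C - w)^-1 + cabs (pfrac P1 ws x)) ^+ 2 <= _).
    by rewrite ler_wpM2l ?pi_ge0// lerXn2r ?nnegrE ?addr_ge0 ?mulr_ge0 ?cabs_ge0.
  rewrite /poisson_sum big_cons -/(poisson_sum ws x) -exprVn -cabsV.
  by apply: cauchy_schwarz_step; rewrite ?cabs_ge0 ?pi_ge0 ?poisson_sum_ge0.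
exists (cabs c * `|Im w|^-1 + M1) => x.
apply: le_trans (GE x) _; apply: lerD => //.
rewrite ler_wpM2l ?cabs_ge0// cabsV lef_pV2 ?posrE ?cabs_gt0//.
rewrite -ler_sqr ?nnegrE ?cabs_ge0// cabs_sqr real_normK ?num_real//.
by case: (w) => a b /=; rewrite add0r sqrrN lerDr sqr_ge0.
Qed.

Lemma continuous_cabs_horner P : continuous (fun x => cabs P.[x%:C]).
Proof.
have ReE x : Re P.[x%:C] = (\poly_(i < size P) Re P`_i).[x].
  rewrite horner_coef horner_poly.
  rewrite (big_morph (@complex.Re R) (@cRe_add R) (erefl : Re (0 : C) = 0)).
  apply: eq_bigr => i _; rewrite -rmorphXn /=.
  by case: (P`_i) => a b /=; rewrite mulr0 subr0.
have ImE x : Im P.[x%:C] = (\poly_(i < size P) Im P`_i).[x].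
  have cIm_add (c d : C) : Im (c + d) = Im c + Im d by case: c d => a b [].
  rewrite horner_coef horner_poly.
  rewrite (big_morph (@complex.Im R) cIm_add (erefl : Im (0 : C) = 0)).
  apply: eq_bigr => i _; rewrite -rmorphXn /=.
  by case: (P`_i) => a b /=; rewrite mulr0 add0r.
have E x : cabs P.[x%:C] = Num.sqrt (((\poly_(i < size P) Re P`_i) ^+ 2 +
   (\poly_(i < size P) Im P`_i) ^+ 2).[x]).
  rewrite hornerD !horner_exp -ReE -ImE -cabs_sqr.
  by rewrite sqrtr_sqr ger0_norm// cabs_ge0.
under [X in continuous X]eq_fun do rewrite E.
move=> x; apply: continuous_comp; first exact: continuous_horner.
exact: sqrt_continuous.
Qed.

Lemma continuous_cabs_pfrac ws P : all lower_half ws ->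
  continuous (fun x => cabs (pfrac P ws x)).
Proof.
move=> lws x.
have -> : (fun x => cabs (pfrac P ws x)) =
  (fun x => cabs P.[x%:C] * (cabs (poly_of_roots ws).[x%:C])^-1).
  by apply/funext => y; rewrite /pfrac cabsM cabsV.
apply: cvgM; first exact: continuous_cabs_horner.
apply: cvgV; last exact: continuous_cabs_horner.
by rewrite cabs_eq0 horner_roots_neq0.
Qed.

End PointwiseBound.

(** * Interpolation between exponents *)

Section Nikolskii.
Variable R : realType.
Implicit Types (f : ratfrac R) (p r x : R) (q : \bar R).

Definition absev f x : R := cabs (ev f x%:C).

Lemma absev_ge0 f x : 0 <= absev f x.
Proof. exact: cabs_ge0. Qed.

Lemma normLE r f :
  normL r%:E f = ((\int[@lebesgue_measure R]_x (absev f x `^ r)%:E) `^ r^-1)%E.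
Proof.
rewrite /normL unlock; congr (_ `^ _)%E; apply: eq_integral => x _.
by rewrite /= ger0_norm ?cabs_ge0.
Qed.

Lemma powR_powRV (a r : R) : 0 <= a -> r != 0 -> (a `^ r) `^ r^-1 = a.
Proof. by move=> a0 r0; rewrite -powRrM mulfV// powRr1. Qed.

Lemma powRV_powR (a r : R) : 0 <= a -> r != 0 -> (a `^ r^-1) `^ r = a.
Proof. by move=> a0 r0; rewrite -powRrM mulVf// powRr1. Qed.

Lemma int_powR_ge0 (phi : R -> R) r :
  (0 <= \int[@lebesgue_measure R]_x (phi x `^ r)%:E)%E.
Proof. by apply: integral_ge0 => x _; rewrite lee_fin powR_ge0. Qed.

(** * Passing from exponent 2 m to the exponents p and q *)

Section Interpolation.
Variables (phi : R -> R) (p K I : R) (m : nat).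
Hypotheses (phi_ge0 : forall x, 0 <= phi x) (phi_cont : continuous phi).
Hypotheses (phi_bounded : exists M, forall x, phi x <= M).
Hypotheses (p_gt0 : 0 < p) (p_le_m : p <= m.*2%:R) (K_ge0 : 0 <= K).
Hypothesis phi_int :
  (\int[@lebesgue_measure R]_x (phi x ^+ m.*2)%:E = I%:E)%E.
Hypothesis phi_pointwise : forall x, phi x ^+ m.*2 <= K * I.

Let measurable_phi_powR r :
  measurable_fun [set: R] (fun x => (phi x `^ r)%:E).
Proof.
apply/measurable_EFinP.
apply: (measurableT_comp (measurable_powR _)).
exact: continuous_measurable_fun.
Qed.

Let int_powR_le r M : (forall x, phi x <= M) -> p <= r ->
  (\int[@lebesgue_measure R]_x (phi x `^ r)%:E <=
   (M `^ (r - p))%:E * \int[@lebesgue_measure R]_x (phi x `^ p)%:E)%E.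
Proof.
move=> phiM pr; have M0 : 0 <= M := le_trans (phi_ge0 0) (phiM 0).
rewrite -ge0_integralZl_EFin ?powR_ge0//; last 2 first.
- by move=> x _; rewrite lee_fin powR_ge0.
- exact: measurable_phi_powR.
apply: ge0_le_integral => //.
- by move=> x _; rewrite lee_fin powR_ge0.
- exact: measurable_phi_powR.
- by apply: measurable_funeM; exact: measurable_phi_powR.
have r0 : 0 < r := lt_le_trans p_gt0 pr.
move=> x _; rewrite -EFinM lee_fin.
have -> : phi x `^ r = phi x `^ (r - p) * phi x `^ p.
  by rewrite -powRD subrK// gt_eqF.
by rewrite ler_wpM2r ?powR_ge0//; apply: ge0_ler_powR; rewrite ?nnegrE ?subr_ge0.
Qed.

(** Let M be the supremum of [phi]. The integral of phi^(2 m) is at most M^(2 m - p) s, so the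
    pointwise hypothesis gives M^(2 m) <= K M^(2 m - p) s. Cancelling the power of M leaves M^p <= K
    s; this is legitimate because M is finite. *)
Let phi_le (s : R) : 0 <= s ->
  (\int[@lebesgue_measure R]_x (phi x `^ p)%:E = s%:E)%E ->
  forall x, phi x <= (K * s) `^ p^-1.
Proof.
move=> s0 sE.
have Sup : has_sup (range phi).
  split; first by exists (phi 0); exists 0.
  by have [M hM] := phi_bounded; exists M => _ [x _ <-].
pose M := sup (range phi).
have phiM x : phi x <= M by apply: sup_upper_bound => //; exists x.
have M0 : 0 <= M := le_trans (phi_ge0 0) (phiM 0).
(* A power of M is cancelled below, so M = 0 is split off. *)
have [M1|M1] := eqVneq M 0.
  by move=> x; rewrite (le_trans (phiM x))// M1 powR_ge0.
have {M1} M_gt0 : 0 < M by rewrite lt0r M1.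
have m2 : m.*2%:R != 0 :> R.
  by rewrite pnatr_eq0; apply: contraTneq p_le_m => ->; rewrite -ltNge.
have I_le : I <= M `^ (m.*2%:R - p) * s.
  rewrite -lee_fin EFinM -sE -phi_int; apply: le_trans (int_powR_le phiM p_le_m).
  rewrite le_eqVlt; apply/orP; left; apply/eqP/eq_integral => x _.
  by rewrite powR_mulrn.
have M_le : M `^ p <= K * s.
  have M_le : M <= (K * (M `^ (m.*2%:R - p) * s)) `^ (m.*2%:R)^-1.
    apply: ge_sup; first by exists (phi 0); exists 0.
    move=> _ [x _ <-].
    rewrite -[leLHS](powR_powRV _ m2)//; apply: ge0_ler_powR.
    - by rewrite invr_ge0.
    - by rewrite nnegrE powR_ge0.
    - by rewrite nnegrE !mulr_ge0 ?powR_ge0.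
    - rewrite powR_mulrn// (le_trans (phi_pointwise x))// ler_wpM2l//.
  have : M `^ m.*2%:R <= K * (M `^ (m.*2%:R - p) * s).
    rewrite -[leRHS](powRV_powR _ m2) ?mulr_ge0 ?powR_ge0//.
    by apply: ge0_ler_powR; rewrite ?nnegrE ?powR_ge0.
  have -> : M `^ m.*2%:R = M `^ (m.*2%:R - p) * M `^ p.
    by rewrite -powRD subrK// (gt_eqF M_gt0) implybT.
  by rewrite mulrCA ler_pM2l// powR_gt0.
move=> x; apply: le_trans (phiM x) _.
rewrite -[leLHS](powR_powRV _ (lt0r_neq0 p_gt0))//.
by apply: ge0_ler_powR; rewrite ?nnegrE ?powR_ge0 ?mulr_ge0 ?invr_ge0// ltW.
Qed.

Lemma sup_norm_interpolation : (sup_norm phi <=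
  K%:E `^ p^-1 * (\int[@lebesgue_measure R]_x (phi x `^ p)%:E) `^ p^-1)%E.
Proof.
(* For K = 0 the right-hand side is 0 even against an infinite integral, as 0 times infinity is 0;
   but then [phi] vanishes. *)
have [K0|K0] := eqVneq K 0.
  have z x : phi x = 0.
    apply/eqP; have := phi_pointwise x; rewrite K0 mul0r le_eqVlt.
    by rewrite expf_eq0 ltNge exprn_ge0// orbF => /andP[].
  apply: le_trans (_ : 0 <= _)%E; last by rewrite mule_ge0// poweR_ge0.
  by apply: ge_ereal_sup => _ [x _ <-]; rewrite z normr0.
have K_gt0 : 0 < K by rewrite lt0r K0.
apply: ge_ereal_sup => _ [x _ <-]; rewrite ger0_norm//.
move: (int_powR_ge0 phi p).
case sE : (\int[@lebesgue_measure R]_x (phi x `^ p)%:E)%E => [s| |]//; last first.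
  move=> _; rewrite poweRyr ?invr_eq0 ?gt_eqF// poweR_EFin.
  by rewrite gt0_muley ?leey// lte_fin powR_gt0.
rewrite lee_fin => s0; rewrite !poweR_EFin -EFinM lee_fin -powRM//.
exact: phi_le.
Qed.

(** When s, the integral of phi^p, is finite, that of phi^r is at most (K s)^((r - p) / p) s by
    [phi_le]; taking the root of order r gives K the exponent 1/p - 1/r and s the exponent 1/p. *)
Lemma Lnorm_interpolation r : p < r ->
  ((\int[@lebesgue_measure R]_x (phi x `^ r)%:E) `^ r^-1 <=
  K%:E `^ (p^-1 - r^-1) * (\int[@lebesgue_measure R]_x (phi x `^ p)%:E) `^ p^-1)%E.
Proof.
move=> pr; have r0 := lt_trans p_gt0 pr.
move: (int_powR_ge0 phi p).
case sE : (\int[@lebesgue_measure R]_x (phi x `^ p)%:E)%E => [s| |]//; last first.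
  move=> _; have [K0|K0] := eqVneq K 0; last first.
    rewrite poweRyr ?invr_eq0 ?gt_eqF// poweR_EFin gt0_muley ?leey//.
    by rewrite lte_fin powR_gt0// lt0r K0.
  have z x : phi x = 0.
    apply/eqP; have := phi_pointwise x; rewrite K0 mul0r le_eqVlt.
    by rewrite expf_eq0 ltNge exprn_ge0// orbF => /andP[].
  apply: le_trans (_ : 0 <= _)%E; last by rewrite mule_ge0// poweR_ge0.
  rewrite (eq_integral (fun=> 0%E)) => [|x _]; last by rewrite z powR0// gt_eqF.
  by rewrite integral0 poweR0r// invr_eq0 gt_eqF.
rewrite lee_fin => s0.
have Ks0 : 0 <= K * s by rewrite mulr_ge0.
have := int_powR_le (phi_le s0 sE) (ltW pr); rewrite sE -EFinM.
move: (int_powR_ge0 phi r).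
case: (\int[@lebesgue_measure R]_x (phi x `^ r)%:E)%E => [t| |]//.
rewrite !lee_fin => t0 ts.
have -> : K `^ (p^-1 - r^-1) * s `^ p^-1 =
   ((K * s) `^ p^-1 `^ (r - p) * s) `^ r^-1.
  rewrite [in RHS]powRM ?powR_ge0// -!powRrM.
  have -> : p^-1 * ((r - p) * r^-1) = p^-1 - r^-1 by field; rewrite !gt_eqF.
  rewrite powRM// -mulrA -powRD subrK//.
  by rewrite gt_eqF// invr_gt0.
by apply: ge0_ler_powR; rewrite ?nnegrE ?invr_ge0 ?mulr_ge0 ?powR_ge0// ltW.
Qed.
End Interpolation.

Lemma normL_le f p q (m : nat) (K I : R) : continuous (absev f) ->
  (exists M, forall x, absev f x <= M) -> 0 < p -> (p%:E < q)%E ->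
  p <= m.*2%:R -> 0 <= K ->
  (\int[@lebesgue_measure R]_x (absev f x ^+ m.*2)%:E = I%:E)%E ->
  (forall x, absev f x ^+ m.*2 <= K * I) ->
  (normL q f <= K%:E `^ (p^-1 - inv_exp q) * normL p%:E f)%E.
Proof.
move=> cf bf p0 pq pm K0 fI fK; rewrite normLE; case: q pq => [r| |]//.
  rewrite lte_fin => pr; rewrite normLE.
  exact: (Lnorm_interpolation (absev_ge0 f) cf bf p0 pm K0 fI fK pr).
rewrite subr0 => _.
exact: (sup_norm_interpolation (absev_ge0 f) cf bf p0 pm K0 fI fK).
Qed.
End Nikolskii.

(** * Poles of rational fractions *)

Section Poles.
Variable R : realType.
Local Notation C := R[i].
Implicit Types (f : ratfrac R) (x : R) (w z : C) (ws : seq C).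
Implicit Types (P Q a b h : {poly C}).

Lemma poly_of_roots_neq0 ws : poly_of_roots ws != 0.
Proof. exact/monic_neq0/monic_prod_XsubC. Qed.

Lemma poly_of_roots_cat ws1 ws2 :
  poly_of_roots (ws1 ++ ws2) = poly_of_roots ws1 * poly_of_roots ws2.
Proof. exact: big_cat. Qed.

Lemma conj_polyM P Q : conj_poly (P * Q) = conj_poly P * conj_poly Q.
Proof. exact: rmorphM. Qed.

Lemma conj_polyK P : conj_poly (conj_poly P) = P.
Proof.
by apply/polyP => i; rewrite /conj_poly !coef_map /= conjcK.
Qed.

Lemma size_conj_poly P : size (conj_poly P) = size P.
Proof. exact: size_map_poly. Qed.

Lemma conj_poly_eq0 P : (conj_poly P == 0) = (P == 0).
Proof. by rewrite -!size_poly_eq0 size_conj_poly. Qed.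

Lemma horner_conj_poly P z : (conj_poly P).[z^*] = (P.[z])^*.
Proof. exact: horner_map. Qed.

Lemma conj_poly_of_roots ws :
  conj_poly (poly_of_roots ws) = poly_of_roots (map (@conjc R) ws).
Proof. by rewrite /conj_poly /poly_of_roots map_prod_XsubC big_map. Qed.

Lemma gcd_numden_neq0 f : gcdp (num f) (den f) != 0.
Proof. by rewrite gcdp_eq0 negb_and den_neq0 orbT. Qed.

Lemma rnumK f : rnum f * gcdp (num f) (den f) = num f.
Proof. by rewrite divpK// dvdp_gcdl. Qed.

Lemma rdenK f : rden f * gcdp (num f) (den f) = den f.
Proof. by rewrite divpK// dvdp_gcdr. Qed.

Lemma rden_neq0 f : rden f != 0.
Proof. by apply: contraNneq (den_neq0 f) => r0; rewrite -rdenK r0 mul0r. Qed.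

Lemma coprime_rnum_rden f : coprimep (rnum f) (rden f).
Proof. by rewrite coprimep_div_gcd// den_neq0 orbT. Qed.

(** Coprimality of [a] and [b] makes [h] associate to the gcd of a h and b h. This reads off the
    reduced denominator from any factorisation, up to a scalar. *)
Lemma rden_eqp f a b h : num f = a * h -> den f = b * h -> h != 0 ->
  coprimep a b -> rden f %= b.
Proof.
move=> nf df h0 cab.
have g_h : gcdp (num f) (den f) %= h.
  rewrite nf df; apply: eqp_trans (gcdp_mul2r _ _ _) _.
  by rewrite -[X in _ %= X]mul1r eqp_mulr// -size_poly_eq1.
rewrite -(eqp_mul2r _ _ h0) -df -[X in _ %= X]rdenK.
by rewrite eqp_mull// eqp_sym.
Qed.

Lemma ev_coprime f z : coprimep (num f) (den f) -> (den f).[z] != 0 ->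
  ev f z = (num f).[z] / (den f).[z].
Proof.
move=> cf dz; rewrite /ev.
rewrite -[X in _ = X.[_] / _]rnumK -[X in _ = _ / X.[_]]rdenK !hornerM.
have : (den f).[z] != 0 by [].
rewrite -[X in X.[_]]rdenK hornerM mulf_eq0 negb_or => /andP[r0 g0].
by field; rewrite r0 g0.
Qed.

Lemma perm_roots_of Q ws : Q != 0 -> Q %= poly_of_roots ws ->
  perm_eq (sval (closed_field_poly_normal Q)) ws.
Proof.
case: (closed_field_poly_normal Q) => s /= QE Q0 Qws; apply: prod_XsubC_eq.
apply/eqP; rewrite -eqp_monic ?monic_prod_XsubC//.
apply: eqp_trans Qws; rewrite QE eqp_sym eqp_scale// lead_coef_eq0 //.
Qed.

Lemma mup_eqp z P Q : P != 0 -> Q != 0 -> P %= Q -> mup z P = mup z Q.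
Proof.
move=> P0 Q0 PQ; apply/eqP; rewrite eqn_leq.
apply/andP; split; first by rewrite mup_geq// -(eqp_dvdr _ PQ) -mup_geq.
by rewrite mup_geq// (eqp_dvdr _ PQ) -mup_geq.
Qed.

(** Distinct poles with multiplicities are exchanged for a list with repetitions. The target is a
    general monoid so that the lemma serves degrees, in [nat], as well as [mu_star], in [R]. *)
Lemma sum_poles (V : nmodType) f ws (c : pred C) (F : C -> V) :
  rden f %= poly_of_roots ws ->
  \sum_(z <- poles f | c z) F z *+ pole_mult f z = \sum_(z <- ws | c z) F z.
Proof.
move=> fws; have pws := perm_roots_of (rden_neq0 f) fws.
rewrite -(perm_big _ pws) -[RHS]big_undup_iterop_count.
apply: eq_bigr => z _.
rewrite /pole_mult (mup_eqp _ (rden_neq0 f) (poly_of_roots_neq0 ws) fws).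
by rewrite mu_prod_XsubC (permP pws).
Qed.

Lemma degreeE f ws : rden f %= poly_of_roots ws -> degree f = size ws.
Proof.
move=> fws; rewrite -sum1_size.
have <- := @sum_poles nat f ws xpredT (fun=> 1%N) fws.
by apply: eq_bigr => z _; rewrite natn.
Qed.

Lemma mem_poles f ws : rden f %= poly_of_roots ws -> poles f =i ws.
Proof.
by move=> fws z; rewrite mem_undup (perm_mem (perm_roots_of (rden_neq0 f) fws)).
Qed.

(** Each conjugate pair of nonreal numbers has exactly one member in the upper half-plane. *)
Let sum_upper_conj (V : nmodType) ws (F : C -> V) :
  (forall w, w \in ws -> Im w != 0) ->
  \sum_(z <- ws ++ map (@conjc R) ws | 0 < Im z) F z =
  \sum_(w <- ws) (if 0 < Im w then F w else F w^*).
Proof.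
move=> ws0; rewrite big_cat big_map /=.
rewrite [X in X + _]big_mkcond [X in _ + X]big_mkcond -big_split /=.
apply: eq_big_seq => w /ws0.
case: w => a b /= b0; rewrite oppr_gt0.
by case: (ltrgtP 0 b) b0 => [_ _|_ _|<-]; rewrite ?eqxx// ?addr0 ?add0r.
Qed.

Lemma star_degreeE f ws : (forall w, w \in ws -> Im w != 0) ->
  rden (star f) %= poly_of_roots (ws ++ map (@conjc R) ws) ->
  star_degree f = size ws.
Proof.
move=> ws0 fws.
have := @sum_poles nat (star f) _ (fun z => 0 < Im z) (fun=> 1%N) fws.
rewrite sum_upper_conj// => h.
rewrite -sum1_size /star_degree.
transitivity (\sum_(w <- ws) (if 0 < Im w then 1%N else 1%N)).
  by rewrite -h; apply: eq_bigr => z _; rewrite natn.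
by apply: eq_bigr => w _; case: ifP.
Qed.

Lemma mu_starE f ws x : (forall w, w \in ws -> Im w != 0) ->
  rden (star f) %= poly_of_roots (ws ++ map (@conjc R) ws) ->
  mu_star f x = poisson_sum ws x.
Proof.
move=> ws0 fws; rewrite /mu_star.
transitivity (\sum_(z <- poles (star f) | 0 < Im z)
    (Im z / cabs (x%:C - z^*) ^+ 2) *+ pole_mult (star f) z).
  by apply: eq_bigr => z _; rewrite -[RHS]mulr_natl mulrA.
rewrite (sum_poles _ _ fws) sum_upper_conj//; apply: eq_big_seq => w /ws0 w0.
case: ltP => [/ltW w1|w1]; first by rewrite cabs_XsubC_conj ger0_norm.
by rewrite !cabs_XsubC_conj ler0_norm//; case: (w).
Qed.
End Poles.

(** * Reduction to poles in the lower half-plane *)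

Section Reduction.
Variable R : realType.
Local Notation C := R[i].
Implicit Types (f : ratfrac R) (x : R) (w z : C) (ws : seq C).
Implicit Types (P Q a b h : {poly C}).

(* On the real line (x - w) and (x - conj w) have the same modulus, so each
   pole can be moved to the lower half-plane. *)
Definition reflect_lower w := if 0 < Im w then w^* else w.

Lemma lower_half_reflect w : Im w != 0 -> lower_half (reflect_lower w).
Proof.
rewrite /reflect_lower /lower_half; case: ifPn => [|wN0 w0].
  by case: w => a b /=; rewrite oppr_lt0.
by rewrite lt_neqAle w0 leNgt.
Qed.

Lemma Im_reflect w : `|Im (reflect_lower w)| = `|Im w|.
Proof. by rewrite /reflect_lower; case: ifP => // _; case: w => a b; exact: normrN. Qed.

Lemma cabs_reflect x w : cabs (x%:C - reflect_lower w) = cabs (x%:C - w).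
Proof. by rewrite /reflect_lower; case: ifP => // _; exact: cabs_XsubC_conj. Qed.

Lemma cabs_poly_of_roots_reflect x ws :
  cabs (poly_of_roots (map reflect_lower ws)).[x%:C] =
  cabs (poly_of_roots ws).[x%:C].
Proof.
elim: ws => [//|w ws IH]; rewrite /= !horner_roots_cons !cabsM IH.
by rewrite cabs_reflect.
Qed.

Lemma poisson_sum_reflect x ws :
  poisson_sum (map reflect_lower ws) x = poisson_sum ws x.
Proof.
rewrite /poisson_sum big_map; apply: eq_bigr => w _.
by rewrite Im_reflect cabs_reflect.
Qed.

Lemma cabs_conj_poly P x : cabs (conj_poly P).[x%:C] = cabs P.[x%:C].
Proof. by rewrite -[LHS]cabs_conj -horner_conj_poly conj_polyK conjc_real. Qed.

(** This replaces [f] by a fraction of equal modulus on the real line to which [pfrac_bound]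
    applies. The number of poles can drop below the degree, exactly by the zeros of [f] conjugate to
    poles. *)
Lemma ratfrac_reduction f : is_proper f -> no_real_pole f ->
  exists ws P, [/\ all lower_half ws, (size P <= size ws)%N,
    (forall x, absev f x = cabs (pfrac P ws x)),
    mu_star f =1 poisson_sum ws &
    (size ws <= degree f)%N /\
    (forall w, w \in ws -> exists2 z, z \in poles f & `|Im w| = `|Im z|)].
Proof.
move=> pf nrf; set p := rnum f; set q := rden f.
have q0 : q != 0 := rden_neq0 f.
have cpq : coprimep p q := coprime_rnum_rden f.
(* [H] gathers the zeros of [f] that are conjugate to poles. On the real line [H] and [conj_poly H]
   have the same modulus, so [H] in the numerator cancels against [conj_poly H] in the
   denominator. *)
pose H := gcdp p (conj_poly q).
have cq0 : conj_poly q != 0 by rewrite conj_poly_eq0.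
have H0 : H != 0 by rewrite gcdp_eq0 negb_and cq0 orbT.
pose p' := p %/ H; pose q1 := conj_poly q %/ H; pose q' := conj_poly q1.
have pE : p = p' * H by rewrite divpK// dvdp_gcdl.
have q1E : conj_poly q = q1 * H by rewrite divpK// dvdp_gcdr.
have qE : q = q' * conj_poly H by rewrite -[LHS]conj_polyK q1E conj_polyM.
have q1q' : conj_poly q' = q1 by rewrite conj_polyK.
have c1 : coprimep p' q1 by rewrite coprimep_div_gcd// cq0 orbT.
have c2 : coprimep p' q'.
  have d1 : p' %| p by rewrite pE dvdp_mulr.
  have d2 : q' %| q by rewrite qE dvdp_mulr.
  by apply: coprimep_dvdl d2 _; apply: coprimep_dvdr d1 _.
have q10 : q1 != 0 by apply: contraNneq cq0 => z; rewrite q1E z mul0r.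
have q'0 : q' != 0 by apply: contraNneq q0 => z; rewrite qE z mul0r.
pose rs := sval (closed_field_poly_normal q').
have q'E : q' = lead_coef q' *: poly_of_roots rs.
  by rewrite /rs; case: (closed_field_poly_normal q').
have q'rs : q' %= poly_of_roots rs.
  by rewrite [X in X %= _]q'E eqp_scale// lead_coef_eq0.
(* Once [H] is removed, [p'] is coprime to [q'] and to its conjugate, so nothing more cancels in
   [star f]. *)
have starE : rden (star f) %= q' * conj_poly q'.
  pose g := gcdp (num f) (den f).
  have hc a b : coprimep (conj_poly a) (conj_poly b) = coprimep a b.
    exact: coprimep_map.
  apply: (@rden_eqp _ _ (p' * conj_poly p') _ (g * conj_poly g * (H * conj_poly H))).
  - rewrite /= -[X in X * _]rnumK -[X in _ * conj_poly X]rnumK -/p -/g pE !conj_polyM.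
    ring.
  - rewrite /= -[X in X * _]rdenK -[X in _ * conj_poly X]rdenK -/q -/g qE !conj_polyM.
    rewrite conj_polyK; ring.
  - by rewrite !mulf_neq0 ?conj_poly_eq0// gcd_numden_neq0.
  - rewrite coprimepMl !coprimepMr c2 q1q' c1 -{1}(conj_polyK q') q1q' !hc.
    by rewrite c1 -[X in coprimep _ X]q1q' hc c2.
have q0x x : q.[x%:C] != 0.
  rewrite -rootE; apply/negP => rx.
  have : x%:C \in poles f.
    rewrite mem_undup -root_prod_XsubC.
    case: (closed_field_poly_normal _) => s /= sE; move: rx.
    by rewrite /q sE rootZ// lead_coef_eq0.
  by move/nrf; rewrite /= eqxx.
have rs_poles z : z \in rs -> z \in poles f.
  move=> zrs; rewrite mem_undup -root_prod_XsubC.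
  case: (closed_field_poly_normal _) => s /= sE.
  have : root q z by rewrite qE rootM (eqp_root q'rs) root_prod_XsubC zrs.
  by rewrite /q sE rootZ// lead_coef_eq0.
have rs0 z : z \in rs -> Im z != 0 by move/rs_poles/nrf.
have srs : size q' = (size rs).+1 by rewrite (eqp_size q'rs) size_poly_of_roots.
exists (map reflect_lower rs), ((lead_coef q')^-1 *: p'); split.
- by rewrite all_map; apply/allP => z /rs0 z0; exact: lower_half_reflect.
(* Properness survives because [H] and [conj_poly H] have the same degree. *)
- rewrite size_scale ?invr_neq0 ?lead_coef_eq0// size_map -ltnS -srs.
  have [->|p'0] := eqVneq p' 0; first by rewrite size_poly0 size_poly_gt0.
  have p0 : p != 0 by rewrite pE mulf_neq0.
  have g0 := gcd_numden_neq0 f.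
  have sn : size (num f) = (size p + size (gcdp (num f) (den f))).-1.
    by rewrite -size_mul ?rnumK.
  have sd : size (den f) = (size q + size (gcdp (num f) (den f))).-1.
    by rewrite -size_mul ?rdenK.
  move: pf; rewrite /is_proper sn sd pE qE !size_mul ?conj_poly_eq0//.
  rewrite !size_conj_poly; move: g0 H0 p'0 q10; rewrite -!size_poly_gt0.
  by move: (size (gcdp (num f) _)) (size H) (size p') (size q1) => a b c d; lia.
- move=> x; rewrite /absev /ev -/p -/q.
  have Hx : cabs H.[x%:C] != 0.
    rewrite cabs_eq0; apply: contra (q0x x) => /eqP Hx.
    by rewrite -cabs_eq0 qE hornerM cabsM (cabs_conj_poly H) Hx cabs0 mulr0.
  rewrite cabsM cabsV pE qE !hornerM !cabsM (cabs_conj_poly H).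
  rewrite invfM mulrACA divff// mulr1.
  rewrite /pfrac hornerZ !cabsM !cabsV cabs_poly_of_roots_reflect.
  have -> : cabs q'.[x%:C] = cabs (lead_coef q') * cabs (poly_of_roots rs).[x%:C].
    by rewrite -cabsM -hornerZ -q'E.
  by rewrite invfM mulrCA mulrA.
- move=> x; rewrite poisson_sum_reflect; apply: mu_starE => //.
  rewrite poly_of_roots_cat -conj_poly_of_roots; apply: eqp_trans starE _.
  apply: eqp_trans (eqp_mulr _ q'rs) _; apply: eqp_mull.
  by move: q'rs; rewrite /eqp !dvdp_map.
- split=> [|_ /mapP[z zrs ->]]; last first.
    by exists z; [exact: rs_poles|rewrite Im_reflect].
  pose s := sval (closed_field_poly_normal q).
  have qs : q %= poly_of_roots s.
    rewrite /s; case: (closed_field_poly_normal q) => t /= tE.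
    by rewrite [X in X %= _]tE eqp_scale// lead_coef_eq0.
  rewrite (degreeE qs) size_map -ltnS -srs -size_poly_of_roots -(eqp_size qs).
  by rewrite dvdp_leq// qE dvdp_mulr.
Qed.
End Reduction.

(** * The inequalities *)

Section JacksonNikolskii.
Variable R : realType.
Local Notation C := R[i].
Implicit Types (f : ratfrac R) (x p : R) (q : \bar R) (w z : C) (ws : seq C).
Implicit Types (P : {poly C}).

(** Repeating the list of poles m times gives the poles of the m-th power of a fraction. *)
Lemma poly_of_roots_flatten_nseq (m : nat) ws :
  poly_of_roots (flatten (nseq m ws)) = poly_of_roots ws ^+ m.
Proof.
elim: m => [|m IH]; first by rewrite /poly_of_roots big_nil.
by rewrite /= poly_of_roots_cat IH exprS.
Qed.

Lemma poisson_sum_flatten_nseq (m : nat) ws x :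
  poisson_sum (flatten (nseq m ws)) x = m%:R * poisson_sum ws x.
Proof.
elim: m => [|m IH]; first by rewrite /poisson_sum big_nil mul0r.
rewrite /poisson_sum in IH *.
by rewrite /= big_cat /= IH -natr1 mulrDl mul1r addrC.
Qed.

(** A real point is at distance at least |Im w| from [w]. Hence the supremum of [mu_star] is
    finite. *)
Lemma poisson_sum_le ws x : (forall w, w \in ws -> Im w != 0) ->
  poisson_sum ws x <= \sum_(w <- ws) `|Im w|^-1.
Proof.
move=> ws0; rewrite /poisson_sum big_seq [leRHS]big_seq; apply: ler_sum => w /ws0 w0.
have w1 : 0 < `|Im w| by rewrite normr_gt0.
rewrite ler_pdivrMr; last by rewrite exprn_gt0// cabs_gt0 real_sub_neq0.
rewrite ler_pdivlMl// -expr2 cabs_sqr real_normK ?num_real//.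
by case: (w) => a b /=; rewrite add0r sqrrN lerDr sqr_ge0.
Qed.

Lemma is_m_gt0 p (m : nat) : 0 < p -> is_m p m -> (0 < m)%N.
Proof.
move=> p0 /andP[pm _]; rewrite lt0n; apply: contraTneq pm => ->.
by rewrite -ltNge divr_gt0.
Qed.

(** The pointwise bound is applied to the m-th power of the reduced fraction, whose Poisson sum is m
    times larger, and interpolation does the rest. An arbitrary bound [S] of [mu_star] is allowed so
    that both inequalities follow: one takes the supremum, the other n / delta. *)
Lemma normL_le_mu f p q (m : nat) (S : R) :
  is_proper f -> no_real_pole f -> 0 < p -> (p%:E < q)%E -> is_m p m ->
  (forall x, mu_star f x <= S) ->
  (normL q f <= (m%:R / pi * S)%:E `^ (p^-1 - inv_exp q) * normL p%:E f)%E.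
Proof.
move=> pf nrf p0 pq pm muS; have m0 := is_m_gt0 p0 pm.
have [ws [P [lws sP fE muE _]]] := ratfrac_reduction pf nrf.
have [_ _ [M hM]] := pfrac_bound lws sP.
have lW : all lower_half (flatten (nseq m ws)).
  by elim: (m) => //= k; rewrite all_cat lws.
have sPm : (size (P ^+ m) <= size (flatten (nseq m ws)))%N.
  have -> : size (flatten (nseq m ws)) = (m * size ws)%N.
    by elim: (m) => //= k IH; rewrite size_cat IH mulSn.
  have [->|P0] := eqVneq P 0; first by rewrite expr0n gtn_eqF// size_poly0.
  apply: leq_trans (size_poly_exp_leq _ _) _; move: sP P0; rewrite -size_poly_gt0.
  by move: (size P) (size ws) => a b; nia.
have [I [I0 hI bI] _] := pfrac_bound lW sPm.
have absE x : absev f x ^+ m.*2 =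
    cabs (pfrac (P ^+ m) (flatten (nseq m ws)) x) ^+ 2.
  rewrite fE /pfrac horner_exp poly_of_roots_flatten_nseq horner_exp -exprVn -exprMn.
  by rewrite cabsX -exprM muln2.
have S0 : 0 <= S by rewrite (le_trans _ (muS 0))// muE poisson_sum_ge0.
apply: (@normL_le _ f p q m _ I) => //.
- by rewrite (_ : absev f = fun x => cabs (pfrac P ws x));
    [exact: continuous_cabs_pfrac|apply/funext].
- by exists M => x; rewrite fE.
- case/andP: pm => pm _; rewrite -muln2 natrM -ler_pdivrMr//.
- by rewrite mulr_ge0// divr_ge0// pi_ge0.
- under eq_integral do rewrite absE.
  apply: has_int_integral => // [x|]; first exact: sqr_ge0.
  have cW := @continuous_cabs_pfrac R _ (P ^+ m) lW.
  under [X in continuous X]eq_fun do rewrite expr2.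
  by move=> x; apply: cvgM; exact: cW.
- move=> x; rewrite absE -(ler_pM2l (pi_gt0 R)) (le_trans (bI x))//.
  rewrite poisson_sum_flatten_nseq -muE.
  have -> : pi * (m%:R / pi * S * I) = m%:R * S * I :> R.
    by have := lt0r_neq0 (pi_gt0 R); move: (pi : R) => k k0; field.
  by rewrite ler_wpM2r// ler_wpM2l.
Qed.

Lemma sup_normP (g : R -> R) (B : R) : (forall x, 0 <= g x <= B) ->
  exists s, [/\ sup_norm g = s%:E, forall x, g x <= s & s <= B].
Proof.
move=> gB.
have h1 : (sup_norm g <= B%:E)%E.
  apply: ge_ereal_sup => _ [x _ <-]; have /andP[g0 gle] := gB x.
  by rewrite lee_fin ger0_norm.
have h2 x : ((g x)%:E <= sup_norm g)%E.
  have /andP[g0 _] := gB x.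
  by apply: ereal_sup_ubound; exists x => //; rewrite ger0_norm.
case: (sup_norm g) h1 h2 => [s| |]//= h1 h2; last by have := h2 0.
by exists s; split=> // x; have := h2 x; rewrite lee_fin.
Qed.

Lemma jackson_nikolskii_mu f p q (m : nat) :
  is_proper f -> no_real_pole f -> 0 < p -> (p%:E < q)%E -> is_m p m ->
  (normL q f <= rhs_mu (m%:R / pi) p q f)%E.
Proof.
move=> pf nrf p0 pq pm.
have [ws [P [_ _ _ muE [_ wsf]]]] := ratfrac_reduction pf nrf.
have ws0 w : w \in ws -> Im w != 0.
  by move=> /wsf[z /nrf z0 wz]; rewrite -normr_eq0 wz normr_eq0.
have [|s [sE mus _]] := @sup_normP (mu_star f) (\sum_(w <- ws) `|Im w|^-1).
  by move=> x; rewrite muE poisson_sum_ge0 poisson_sum_le.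
rewrite /rhs_mu sE; exact: normL_le_mu.
Qed.

(** Each of the at most n terms of the Poisson sum is below 1 / delta. *)
Lemma jackson_nikolskii_strip f (delta p : R) q (m : nat) :
  is_proper f -> 0 < delta -> poles_outside_strip delta f ->
  0 < p -> (p%:E < q)%E -> is_m p m ->
  (normL q f <= rhs_strip (m%:R / pi) delta p q f)%E.
Proof.
move=> pf d0 strip p0 pq pm.
have nrf : no_real_pole f.
  by move=> z /strip; apply: contra => /eqP ->; rewrite normr0 ltW.
have [ws [P [_ _ _ muE [sws wsf]]]] := ratfrac_reduction pf nrf.
have wsd w : w \in ws -> delta < `|Im w|.
  by move=> /wsf[z /strip zd ->]; rewrite ltNge.
rewrite /rhs_strip -mulrA; apply: normL_le_mu => // x.
rewrite muE (le_trans (poisson_sum_le _ _))//.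
  by move=> w /wsd wd; rewrite -normr_gt0 (lt_trans d0).
apply: (@le_trans _ _ (\sum_(w <- ws) delta^-1)).
  rewrite big_seq [leRHS]big_seq; apply: ler_sum => w /wsd wd.
  by rewrite lef_pV2 ?posrE// ?(lt_trans d0)// ltW.
rewrite big_const_seq count_predT iter_addr_0 -[leLHS]mulr_natl.
by rewrite ler_wpM2r ?invr_ge0 ?ler_nat// ltW.
Qed.

End JacksonNikolskii.

(** * Sharpness *)

Section Sharpness.
Variable R : realType.
Local Notation C := R[i].
Implicit Types (f : ratfrac R) (x p : R) (w z : C) (ws : seq C) (P : {poly C}).

Lemma coprimep_poly_of_roots P ws : (forall w, w \in ws -> P.[w] != 0) ->
  coprimep P (poly_of_roots ws).
Proof.
elim: ws => [_|w ws IH h]; first by rewrite /poly_of_roots big_nil coprimep1.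
rewrite /poly_of_roots big_cons coprimepMr coprimep_XsubC rootE h ?mem_head//=.
by apply: IH => z zws; apply: h; rewrite inE zws orbT.
Qed.

(** Examples for sharpness are built here. Nonvanishing of [P] at the poles prevents cancellation in
    [f], and at their conjugates prevents cancellation in [star f], so both degrees equal the number
    of listed poles. *)
Lemma lower_ratfrac P ws : all lower_half ws -> (size P <= size ws)%N ->
  (forall w, w \in ws -> P.[w] != 0 /\ P.[w^*] != 0) ->
  exists f, [/\ is_proper f, poles f =i ws, degree f = size ws,
    star_degree f = size ws &
    mu_star f =1 poisson_sum ws /\ forall x, absev f x = cabs (pfrac P ws x)].
Proof.
move=> lws sP Pws; exists (RatFrac P (poly_of_roots_neq0 ws)).
set f := RatFrac _ _; pose Q := poly_of_roots ws.
have cPQ : coprimep P Q by apply: coprimep_poly_of_roots => w /Pws[].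
have fws : rden f %= poly_of_roots ws.
  by apply: (@rden_eqp _ _ P _ 1); rewrite /= ?mulr1 ?oner_neq0.
have ws0 w : w \in ws -> Im w != 0 by move=> /(allP lws) w0; rewrite lt_eqF.
have sws : rden (star f) %= poly_of_roots (ws ++ map (@conjc R) ws).
  rewrite poly_of_roots_cat -conj_poly_of_roots.
  apply: (@rden_eqp _ _ (P * conj_poly P) _ 1); rewrite /= ?mulr1 ?oner_neq0//.
  have cPQ' : coprimep P (conj_poly Q).
    rewrite conj_poly_of_roots; apply: coprimep_poly_of_roots.
    by move=> _ /mapP[w /Pws[_ ? ->]].
  have hc a b : coprimep (conj_poly a) (conj_poly b) = coprimep a b.
    exact: coprimep_map.
  rewrite coprimepMl !coprimepMr cPQ cPQ' /= hc cPQ andbT.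
  by rewrite -(conj_polyK (poly_of_roots ws)) hc.
split.
- by rewrite /is_proper /= size_poly_of_roots ltnS.
- exact: mem_poles.
- exact: degreeE.
- exact: star_degreeE.
split=> x; first exact: mu_starE.
by rewrite /absev ev_coprime// horner_roots_neq0.
Qed.

Lemma absev_le_normL f x : ((absev f x)%:E <= normL +oo f)%E.
Proof.
by apply: ereal_sup_ubound; exists x => //; rewrite ger0_norm// absev_ge0.
Qed.

Lemma poweR_normL_le f p (K S : R) : 0 < p -> 0 <= K ->
  (\int[@lebesgue_measure R]_x (absev f x `^ p)%:E <= S%:E)%E ->
  (K%:E `^ p^-1 * normL p%:E f <= ((K * S) `^ p^-1)%:E)%E.
Proof.
move=> p0 K0 fS.
have i0 := int_powR_ge0 (absev f) p.
have S0 : 0 <= S by rewrite -lee_fin (le_trans i0).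
have pV0 : 0 <= p^-1 by rewrite invr_ge0 ltW.
rewrite powRM// EFinM -!poweR_EFin normLE; apply: lee_wpmul2l; first exact: poweR_ge0.
apply: gt0_ler_poweR => //; rewrite in_itv /= leey andbT//; rewrite lee_fin//.
Qed.

(** For sharpness upper bounds on [mu_star] and on the integral suffice; the left-hand side is
    bounded below by the value at 0. *)
Lemma rhs_mu_le f c p (M S : R) : 0 < p -> 0 <= c ->
  (forall x, 0 <= mu_star f x <= M) ->
  (\int[@lebesgue_measure R]_x (absev f x `^ p)%:E <= S%:E)%E ->
  (rhs_mu c p +oo f <= ((c * M * S) `^ p^-1)%:E)%E.
Proof.
move=> p0 c0 muM fS; have [s [sE sle sM]] := sup_normP muM.
have s0 : 0 <= s by have /andP[m0 _] := muM 0; exact: le_trans (sle 0).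
rewrite /rhs_mu sE subr0 -EFinM.
apply: le_trans (poweR_normL_le p0 (mulr_ge0 c0 s0) fS) _.
have S0 : 0 <= S by rewrite -lee_fin (le_trans (int_powR_ge0 (absev f) p)).
rewrite lee_fin; apply: ge0_ler_powR.
- by rewrite invr_ge0 ltW.
- by rewrite nnegrE !mulr_ge0.
- by rewrite nnegrE !mulr_ge0// (le_trans s0).
- by rewrite ler_wpM2r// ler_wpM2l.
Qed.

Lemma rhs_strip_le f c delta p (S : R) : 0 < p -> 0 <= c -> 0 < delta ->
  (\int[@lebesgue_measure R]_x (absev f x `^ p)%:E <= S%:E)%E ->
  (rhs_strip c delta p +oo f <= ((c * (degree f)%:R / delta * S) `^ p^-1)%:E)%E.
Proof.
move=> p0 c0 d0 fS; rewrite /rhs_strip subr0; apply: poweR_normL_le => //.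
by rewrite divr_ge0 ?mulr_ge0// ltW.
Qed.

Lemma powRV_lt p (A B : R) : 0 < p -> 0 <= A -> 0 <= B -> A < B `^ p -> A `^ p^-1 < B.
Proof.
move=> p0 A0 B0 AB; rewrite -[ltRHS](powR_powRV B0 (lt0r_neq0 p0)).
by apply: gt0_ltr_powR; rewrite ?invr_gt0 ?nnegrE ?powR_ge0.
Qed.

Lemma integral_powR_le f p (g : R -> R) (I : R) : continuous (absev f) ->
  (forall x, absev f x `^ p <= g x) -> continuous g -> has_int g I ->
  (\int[@lebesgue_measure R]_x (absev f x `^ p)%:E <= I%:E)%E.
Proof.
move=> cf fg cg gI.
have g0 x : 0 <= g x by rewrite (le_trans _ (fg x))// powR_ge0.
rewrite -(has_int_integral g0 cg gI); apply: ge0_le_integral => //.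
- by move=> x _; rewrite lee_fin powR_ge0.
- apply/measurable_EFinP/(measurableT_comp (measurable_powR _)).
  exact: continuous_measurable_fun.
- by apply/measurable_EFinP; exact: continuous_measurable_fun.
- by move=> x _; rewrite lee_fin.
Qed.

End Sharpness.

(** * A simple pole with a perturbing factor *)

Section Extremal.
Variable R : realType.
Local Notation C := R[i].
Implicit Types (f : ratfrac R) (x a b p : R) (w z : C) (ws : seq C) (P : {poly C}).

Lemma cabs_real a : cabs (a%:C : C) = `|a|.
Proof. by rewrite /cabs /= expr0n addr0 sqrtr_sqr. Qed.

Lemma cabs_imag b : cabs (0 +i* b) = `|b|.
Proof. by rewrite /cabs /= expr0n add0r sqrtr_sqr. Qed.

Lemma horner_roots_nseq (n : nat) w z :
  (poly_of_roots (nseq n w)).[z] = (z - w) ^+ n.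
Proof.
elim: n => [|n IH]; first by rewrite /poly_of_roots big_nil hornerC.
by rewrite /= horner_roots_cons IH exprS.
Qed.

Lemma all_lower_nseq (n : nat) w : lower_half w -> all lower_half (nseq n w).
Proof. by move=> lw; rewrite all_nseq lw orbT. Qed.

(** With u = 1 / (x + i a) one has |u|^2 - Re (u^2) = 2 (Im u)^2 = 2 a^2 |u|^4, and u^2 integrates
    to 0. *)
Lemma has_int_pole_four a : 0 < a ->
  has_int (fun x => cabs (x%:C - (0 -i* a))^-1 ^+ 4) (pi / (2 * a ^+ 3)).
Proof.
move=> a0; have aN : Im (0 -i* a) < 0 by rewrite /= oppr_lt0.
have a1 : a != 0 by rewrite gt_eqF.
have h1 := has_int_pole_sqr aN.
have h2 := has_intC_poleX 0 aN 1.
have := has_intZ (2 * a ^+ 2)^-1 (has_intD h1 (has_intZ (-1) h2)).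
have -> : (2 * a ^+ 2)^-1 * (pi / `|Im (0 -i* a)| + -1 * Re (1 * 0)) =
    pi / (2 * a ^+ 3).
  rewrite /= normrN gtr0_norm//.
  by move: (pi : R) => k; field.
apply: has_int_ext => x.
rewrite mul1r -exprVn (_ : 4%N = (2 * 2)%N)// exprM cabs_sqr.
rewrite inv_XsubC expr2 /=.
have q0 : x ^+ 2 + a ^+ 2 != 0 by rewrite lt0r_neq0// sqr_add_sqr_gt0.
by field; rewrite sqrrN q0.
Qed.

Lemma continuous_absev_lower f P ws : all lower_half ws ->
  (forall x, absev f x = cabs (pfrac P ws x)) -> continuous (absev f).
Proof.
move=> lws fE; rewrite (_ : absev f = fun x => cabs (pfrac P ws x)).
  exact: continuous_cabs_pfrac.
exact/funext.
Qed.

(* The factor (b / (x + i b)) ^ k raises the degree, and tends to 1 as b grows. *)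
Lemma perturbed_simple_pole a b (k : nat) : 0 < a -> 0 < b ->
  exists f, [/\ is_proper f, (forall z, z \in poles f -> Im z = - a \/ Im z = - b),
    degree f = k.+1, star_degree f = k.+1 &
    [/\ absev f 0 = a^-1, (forall x, 0 <= mu_star f x <= a^-1 + k%:R / b),
      (\int[@lebesgue_measure R]_x (absev f x `^ 2)%:E <= (pi / a)%:E)%E &
      (\int[@lebesgue_measure R]_x (absev f x `^ 4)%:E <= (pi / (2 * a ^+ 3))%:E)%E]].
Proof.
move=> a0 b0.
have laN : Im (0 -i* a) < 0 by rewrite /= oppr_lt0.
have lb : lower_half (0 -i* b) by rewrite /lower_half /= oppr_lt0.
set ws := (0 -i* a) :: nseq k (0 -i* b).
have lws : all lower_half ws by rewrite /= [lower_half _]laN all_lower_nseq.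
have bk0 : ((b ^+ k)%:C : C) != 0.
  by rewrite -cabs_eq0 cabs_real normr_eq0 expf_neq0// gt_eqF.
have [|w _|f [pf polesE dE sdE [muE fE]]] := @lower_ratfrac R ((b ^+ k)%:C)%:P ws lws.
- by rewrite (leq_trans (size_polyC_leq1 _)).
- by rewrite !hornerC.
have sws : size ws = k.+1 by rewrite /= size_nseq.
have cf := continuous_absev_lower lws fE.
have fE' x : absev f x = cabs (x%:C - (0 -i* a))^-1 *
    (b / cabs (x%:C - (0 -i* b))) ^+ k.
  rewrite fE /pfrac hornerC horner_roots_cons horner_roots_nseq invfM mulrCA !cabsM.
  rewrite cabs_real ger0_norm ?exprn_ge0 ?ltW//; congr (_ * _).
  by rewrite cabsV cabsX exprMn exprVn.
have c0 c : 0 < c -> cabs ((0 : R)%:C - (0 -i* c)) = c.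
  move=> c0; have -> : (0 : R)%:C - (0 -i* c) = 0 +i* c :> C.
    by apply/eqP; rewrite eq_complex /= subr0 sub0r opprK !eqxx.
  by rewrite cabs_imag gtr0_norm.
(* The extra factor has modulus at most 1 on the real line, so the integrals do not exceed those of
   the simple pole; at 0 its modulus is 1. *)
have fle x : absev f x <= cabs (x%:C - (0 -i* a))^-1.
  rewrite fE' ler_piMr ?cabs_ge0// exprn_ile1//.
    by rewrite divr_ge0 ?cabs_ge0// ltW.
  have hb : b <= cabs (x%:C - (0 -i* b)).
    rewrite -ler_sqr ?nnegrE ?cabs_ge0 ?(ltW b0)// cabs_sqr /=.
    by rewrite subr0 sub0r opprK lerDr sqr_ge0.
  by rewrite ler_pdivrMr ?mul1r// (lt_le_trans b0).
have ca : continuous (fun x => cabs (x%:C - (0 -i* a))^-1).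
  have la : all lower_half [:: 0 -i* a] by rewrite /= [lower_half _]laN.
  have -> : (fun x => cabs (x%:C - (0 -i* a))^-1) =
      (fun x => cabs (pfrac 1 [:: 0 -i* a] x)).
    apply/funext => x; rewrite /pfrac horner_roots_cons /poly_of_roots big_nil.
    by rewrite !hornerC mulr1 mul1r.
  exact: continuous_cabs_pfrac.
have cX (n : nat) : continuous (fun x => cabs (x%:C - (0 -i* a))^-1 ^+ n).
  elim: n => [|n IH] x; first by under eq_fun do rewrite expr0; exact: cvg_cst.
  under [X in continuous_at _ X]eq_fun do rewrite exprS.
  by apply: cvgM; [exact: ca|exact: IH].
exists f; rewrite dE sdE sws; split=> //.
  move=> z; rewrite polesE inE => /orP[/eqP ->|]; first by left.
  by rewrite mem_nseq => /andP[_ /eqP ->]; right.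
split.
- rewrite fE' cabsV !c0// divff ?expr1n ?mulr1// gt_eqF//.
- move=> x; rewrite muE poisson_sum_ge0 /=.
  rewrite (le_trans (poisson_sum_le _ _))//.
    by move=> w /(allP lws) w0; rewrite lt_eqF.
  rewrite big_cons big_nseq iter_addr_0 /= !normrN !gtr0_norm//.
  by rewrite mulr_natl.
- apply: (integral_powR_le cf _ (cX 2)) => [x|].
    by rewrite (powR_mulrn 2) ?absev_ge0// lerXn2r ?nnegrE ?absev_ge0 ?cabs_ge0.
  by have := has_int_pole_sqr laN; rewrite /= normrN gtr0_norm.
- apply: (integral_powR_le cf _ (cX 4)) => [x|]; last exact: has_int_pole_four.
  by rewrite (powR_mulrn 4) ?absev_ge0// lerXn2r ?nnegrE ?absev_ge0 ?cabs_ge0.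
Qed.

End Extremal.

(** * The reproducing kernel for a single multiple pole *)

Section Kernel.
Variable R : realType.
Local Notation C := R[i].
Implicit Types (f : ratfrac R) (x a b p : R) (w z : C) (ws : seq C) (P : {poly C}).

(* Numerator over (x - w) ^ n of the reproducing kernel at Re w of the space of
   fractions with a single pole w of order at most n. *)
Fixpoint kernel_num w (n : nat) : {poly C} :=
  if n is n'.+1 then
    1 *: poly_of_roots (nseq n' w) + ('X - (w^*)%:P) * - kernel_num w n'
  else 0.

Lemma size_kernel_num w (n : nat) : (size (kernel_num w n) <= n)%N.
Proof.
elim: n => [|n IH] /=; first by rewrite size_poly0.
rewrite (leq_trans (size_polyD _ _))// geq_max scale1r.
rewrite size_poly_of_roots size_nseq leqnn /=.
rewrite (leq_trans (size_polyMleq _ _))// size_XsubC size_polyN.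
by move: IH; move: (size _) => s; lia.
Qed.

(** Each unfolding of [kernel_num] is an orthogonal splitting with c = 1, so it adds the integral of
    |x - w|^-2. *)
Lemma has_int_kernel w (n : nat) : Im w < 0 ->
  has_int (fun x => cabs (pfrac (kernel_num w n) (nseq n w) x) ^+ 2)
    (n%:R * (pi / `|Im w|)).
Proof.
move=> w0; elim: n => [|n IH].
  rewrite mul0r; apply: has_int_ext (@has_int0 R) => x.
  by rewrite /pfrac horner0 mul0r cabs0 expr0n.
have c1 : cabs (1 : C) = 1 by exact: Normc.normc1.
have := @has_int_pfrac_cons R w (nseq n w) 1 (- kernel_num w n) (n%:R * (pi / `|Im w|)).
rewrite c1 expr1n -mulrDl nat1r; apply.
- exact: (@all_lower_nseq R n.+1).
- by rewrite size_polyN size_nseq size_kernel_num.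
- apply: has_int_ext IH => x.
  by rewrite /pfrac hornerN mulNr /cabs normcN.
Qed.

(** At [w] only the second term of the recursion survives. This value and the one at the conjugate
    of [w] are nonzero, as [lower_ratfrac] requires. *)
Lemma horner_kernel_pole w (n : nat) :
  (kernel_num w n.+1).[w] = (w^* - w) ^+ n.
Proof.
elim: n => [|n IH].
  by rewrite /= oppr0 mulr0 addr0 scale1r /poly_of_roots big_nil hornerC.
rewrite [kernel_num w n.+2]/= -/(kernel_num w n.+1) scale1r hornerD hornerM hornerN IH.
rewrite hornerXsubC (horner_roots_nseq n.+1) subrr expr0n add0r exprS; ring.
Qed.

Lemma horner_kernel_conj w (n : nat) :
  (kernel_num w n.+1).[w^*] = (w^* - w) ^+ n.
Proof.
by rewrite /= scale1r hornerD hornerM hornerXsubC subrr mul0r addr0 horner_roots_nseq.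
Qed.

(** Cleared of denominators, this says that the kernel takes the value n / (i a) at 0. There the
    quotient of x - conj w by x - w is -1, which the minus sign in [kernel_num] compensates, so the
    n contributions add up in phase. *)
Lemma horner_kernel_center a (n : nat) :
  (0 +i* a) * (kernel_num (0 -i* a) n).[0] = n%:R * (0 +i* a) ^+ n.
Proof.
have wc : (0 -i* a)^* = 0 +i* a :> C by rewrite /= opprK.
have w0 : 0 - (0 -i* a) = 0 +i* a :> C.
  by apply/eqP; rewrite eq_complex /= subr0 sub0r opprK !eqxx.
move: (0 -i* a) wc w0 => w wc w0.
elim: n => [|n IH]; first by rewrite /= horner0 mulr0 mul0r.
rewrite [kernel_num _ _]/= scale1r hornerD hornerM hornerN hornerXsubC.
rewrite horner_roots_nseq wc w0 mulrDr -exprS sub0r mulrNN mulrCA mulrA -mulrA IH.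
by rewrite -nat1r exprS; ring.
Qed.

(** The three values turn the pointwise bound into an equality at 0: (1 / pi) (n / a) (n pi / a) =
    (n / a)^2. *)
Lemma extremal_pole_kernel a (n : nat) : 0 < a -> (0 < n)%N ->
  exists f, [/\ is_proper f, (forall z, z \in poles f -> Im z = - a),
    degree f = n, star_degree f = n &
    [/\ absev f 0 = n%:R / a, (forall x, 0 <= mu_star f x <= n%:R / a) &
      (\int[@lebesgue_measure R]_x (absev f x `^ 2)%:E <= (n%:R * (pi / a))%:E)%E]].
Proof.
move=> a0 n0; set w := 0 -i* a : C.
have wN : Im w < 0 by rewrite /= oppr_lt0.
have lws := all_lower_nseq n wN.
have ww : w^* - w != 0.
  by apply/eqP => /(congr1 (@complex.Im R)) /=; rewrite !opprK; lra.
have [|z|f [pf polesE dE sdE [muE fE]]] := @lower_ratfrac R (kernel_num w n) _ lws.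
- by rewrite size_nseq size_kernel_num.
- rewrite mem_nseq => /andP[_ /eqP ->]; rewrite -(prednK n0).
  by rewrite horner_kernel_pole horner_kernel_conj !expf_neq0.
exists f; rewrite dE sdE size_nseq; split=> //.
  by move=> z; rewrite polesE mem_nseq => /andP[_ /eqP ->].
have ca : cabs (0 +i* a) = a by rewrite cabs_imag gtr0_norm.
have cf := continuous_absev_lower lws fE.
split.
- rewrite fE /pfrac horner_roots_nseq.
  have -> : (0 : R)%:C - w = 0 +i* a :> C.
    by apply/eqP; rewrite eq_complex /= subr0 sub0r opprK !eqxx.
  have /(congr1 (@cabs R)) := horner_kernel_center a n.
  rewrite !cabsM cabsV !cabsX ca -/w (_ : (0 : R)%:C = 0)//.
  have -> : cabs (n%:R : C) = n%:R.
    by rewrite -(rmorph_nat (real_complex R)) cabs_real ger0_norm.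
  have an : a ^+ n != 0 by rewrite expf_neq0// gt_eqF.
  have a1 : a != 0 by rewrite gt_eqF.
  by move=> e; apply: (mulfI a1); rewrite mulrA e; field; rewrite an a1.
- move=> x; rewrite muE poisson_sum_ge0 /=.
  rewrite (le_trans (poisson_sum_le _ _))//.
    by move=> z /(allP lws) z0; rewrite lt_eqF.
  by rewrite big_nseq iter_addr_0 /= normrN gtr0_norm// mulr_natl.
- have hI := has_int_kernel n wN; rewrite /= normrN (gtr0_norm a0) in hI.
  apply: (integral_powR_le cf _ _ hI) => x.
    by rewrite (powR_mulrn 2) ?absev_ge0// fE.
  have cW := @continuous_cabs_pfrac R _ (kernel_num w n) lws.
  under [X in continuous_at _ X]eq_fun do rewrite expr2.
  by apply: cvgM; exact: cW.
Qed.

End Kernel.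

Lemma is_m2 (R : realType) (m : nat) : is_m (2 : R) m -> m = 1%N.
Proof.
rewrite /is_m divff ?pnatr_eq0// (_ : 1 + 1 = 2%:R)// ler1n ltr_nat => /andP[m1 m2].
by apply/eqP; rewrite eqn_leq m1 -ltnS m2.
Qed.

Lemma is_m4 (R : realType) (m : nat) : is_m (4 : R) m -> m = 2%N.
Proof.
have -> : is_m (4 : R) m = (2%:R <= m%:R :> R) && (m%:R < 3%:R :> R) :> Prop.
  rewrite /is_m; congr (is_true (_ && _)); congr (_ _ _); lra.
rewrite ler_nat ltr_nat => /andP[m1 m2].
by apply/eqP; rewrite eqn_leq m1 -ltnS m2.
Qed.

(** * Comparison of constants *)

Section SharpConstants.
Variable R : realType.
Implicit Types (f : ratfrac R) (c p M S B : R).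

Lemma rhs_mu_lt_normL f c p M S : 0 < p -> 0 <= c ->
  (forall x, 0 <= mu_star f x <= M) ->
  (\int[@lebesgue_measure R]_x (absev f x `^ p)%:E <= S%:E)%E ->
  c * M * S < absev f 0 `^ p -> (rhs_mu c p +oo f < normL +oo f)%E.
Proof.
move=> p0 c0 muM fS lt0; apply: lt_le_trans (absev_le_normL f 0).
apply: le_lt_trans (rhs_mu_le p0 c0 muM fS) _; rewrite lte_fin.
have S0 : 0 <= S by rewrite -lee_fin (le_trans (int_powR_ge0 (absev f) p)).
have M0 : 0 <= M by have /andP[m0] := muM 0; exact: le_trans.
by apply: powRV_lt => //; rewrite ?absev_ge0// !mulr_ge0.
Qed.

Lemma rhs_mu_le_normL f c p M S : 0 < p -> 0 <= c ->
  (forall x, 0 <= mu_star f x <= M) ->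
  (\int[@lebesgue_measure R]_x (absev f x `^ p)%:E <= S%:E)%E ->
  c * M * S = absev f 0 `^ p -> (rhs_mu c p +oo f <= normL +oo f)%E.
Proof.
move=> p0 c0 muM fS eq0; apply: le_trans (absev_le_normL f 0).
apply: le_trans (rhs_mu_le p0 c0 muM fS) _; rewrite lee_fin eq0.
by rewrite powR_powRV// ?absev_ge0// gt_eqF.
Qed.

Lemma rhs_strip_lt_normL f c delta p S : 0 < p -> 0 <= c -> 0 < delta ->
  (\int[@lebesgue_measure R]_x (absev f x `^ p)%:E <= S%:E)%E ->
  c * (degree f)%:R / delta * S < absev f 0 `^ p ->
  (rhs_strip c delta p +oo f < normL +oo f)%E.
Proof.
move=> p0 c0 d0 fS lt0; apply: lt_le_trans (absev_le_normL f 0).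
apply: le_lt_trans (rhs_strip_le p0 c0 d0 fS) _; rewrite lte_fin.
have S0 : 0 <= S by rewrite -lee_fin (le_trans (int_powR_ge0 (absev f) p)).
by apply: powRV_lt => //; rewrite ?absev_ge0// !mulr_ge0 ?invr_ge0// ltW.
Qed.

Lemma large_factor d (k : nat) : 0 <= d < 1 ->
  exists2 b : R, 0 < b & d * (1 + k%:R / b) < 1.
Proof.
move=> /andP[d0 d1]; have d1' : 0 < 1 - d by rewrite subr_gt0.
have e0 : 0 <= k%:R * d / (1 - d) by rewrite divr_ge0 ?mulr_ge0// ltW.
(* The required inequality means b > k d / (1 - d). *)
exists (k%:R * d / (1 - d) + 1); first by rewrite ltr_wpDl.
set b := _ + 1; have b0 : 0 < b by rewrite ltr_wpDl.
rewrite mulrDr mulr1 -ltrBrDl mulrA ltr_pdivrMr//.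
have -> : (1 - d) * b = d * k%:R + (1 - d) by rewrite /b; field; rewrite gt_eqF.
by rewrite ltrDl.
Qed.

(** Poles must stay strictly outside the closed strip, so extremal fractions with poles at height
    delta are only approached; a constant smaller by a factor [d] leaves room for a height slightly
    above delta. *)
Lemma strip_height delta d : 0 < delta -> 0 <= d < 1 ->
  exists2 a : R, delta < a & d * a < delta.
Proof.
move=> d0 /andP[dd0 dd1]; have s0 : 0 < 1 + d by rewrite ltr_wpDr.
(* For d > 0 this is the harmonic mean of delta and delta / d. *)
exists (delta * (2 / (1 + d))).
  by rewrite ltr_pMr// ltr_pdivlMr// mul1r; lra.
rewrite mulrCA gtr_pMr// mulrA ltr_pdivrMr// mul1r; lra.
Qed.

End SharpConstants.

Theorem theorem4p2 (R : realType) :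
  (* inequality (1) *)
  (forall (f : ratfrac R) (p : R) (q : \bar R) (m : nat),
     is_proper f -> no_real_pole f ->
     0 < p -> (p%:E < q)%E -> is_m p m ->
     (normL q f <= rhs_mu (m%:R / pi) p q f)%E) /\
  (* inequality (2) *)
  (forall (f : ratfrac R) (delta p : R) (q : \bar R) (m : nat),
     is_proper f -> 0 < delta -> poles_outside_strip delta f ->
     0 < p -> (p%:E < q)%E -> is_m p m ->
     (normL q f <= rhs_strip (m%:R / pi) delta p q f)%E) /\
  (* (1) is sharp for (oo, 2) and (oo, 4): equality is attained (in every
     degree when p = 2), and in no degree can m_p / pi be decreased *)
  (forall n m : nat, (0 < n)%N -> is_m (2 : R) m ->
     exists f : ratfrac R,
       [/\ is_proper f, no_real_pole f, degree f = n, star_degree f = degree f &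
           normL +oo%E f = rhs_mu (m%:R / pi) 2 +oo%E f]) /\
  (forall m : nat, is_m (4 : R) m ->
     exists f : ratfrac R,
       [/\ is_proper f, no_real_pole f, (0 < degree f)%N, star_degree f = degree f &
           normL +oo%E f = rhs_mu (m%:R / pi) 4 +oo%E f]) /\
  (forall (p : R) (n m : nat) (c : R),
     p = 2 \/ p = 4 -> (0 < n)%N -> is_m p m -> 0 <= c < m%:R / pi ->
     exists f : ratfrac R,
       [/\ is_proper f, no_real_pole f, degree f = n, star_degree f = degree f &
           (rhs_mu c p +oo%E f < normL +oo%E f)%E]) /\
  (* (2) is sharp for (oo, 2) and (oo, 4): for every delta, m_p / pi cannot be
     decreased (in any degree when p = 2) *)
  (forall (delta : R) (n m : nat) (c : R),
     0 < delta -> (0 < n)%N -> is_m (2 : R) m -> 0 <= c < m%:R / pi ->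
     exists f : ratfrac R,
       [/\ is_proper f, poles_outside_strip delta f, degree f = n, star_degree f = degree f &
           (rhs_strip c delta 2 +oo%E f < normL +oo%E f)%E]) /\
  (forall (delta : R) (m : nat) (c : R),
     0 < delta -> is_m (4 : R) m -> 0 <= c < m%:R / pi ->
     exists f : ratfrac R,
       [/\ is_proper f, poles_outside_strip delta f, (0 < degree f)%N, star_degree f = degree f &
           (rhs_strip c delta 4 +oo%E f < normL +oo%E f)%E]).
Proof.
have p20 : 0 < 2 :> R by [].
have p40 : 0 < 4 :> R by [].
have pi0 : 0 < pi :> R := pi_gt0 R.
have piV0 (m : nat) : 0 <= m%:R / pi :> R by rewrite divr_ge0// ltW.
split; first by move=> f p q m; exact: jackson_nikolskii_mu.
split; first by move=> f delta p q m; exact: jackson_nikolskii_strip.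
split.
  move=> n m n0 m2.
  have [f [pf poles dE sdE [f0 muf intf]]] :=
    extremal_pole_kernel (ltr01 : 0 < 1 :> R) n0.
  have nrf : no_real_pole f.
    by move=> z /poles ->; rewrite oppr_eq0 oner_neq0.
  exists f; rewrite sdE dE; split=> //.
  apply/eqP; rewrite eq_le jackson_nikolskii_mu ?ltry//=.
  apply: (rhs_mu_le_normL _ _ muf intf) => //.
  rewrite f0 (is_m2 m2) divr1 (powR_mulrn 2)//.
  by move: (pi : R) pi0 => k k0; field; rewrite gt_eqF.
split.
  move=> m m4.
  (* With k = 0 only the simple pole at -i remains, and (2 / pi) * 1 * (pi / 2) = 1 is the fourth
     power of the value at 0. *)
  have [f [pf poles dE sdE [f0 muf _ intf]]] :=
    perturbed_simple_pole 0 (ltr01 : 0 < 1 :> R) (ltr01 : 0 < 1 :> R).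
  have nrf : no_real_pole f.
    by move=> z /poles[] ->; rewrite oppr_eq0 oner_neq0.
  exists f; rewrite sdE dE; split=> //.
  apply/eqP; rewrite eq_le jackson_nikolskii_mu ?ltry//=.
  apply: (rhs_mu_le_normL _ _ muf intf) => //.
  rewrite f0 (is_m4 m4) (powR_mulrn 4)//.
  by move: (pi : R) pi0 => k k0; field; rewrite gt_eqF.
split.
  move=> p n m c p24 n0 pm /andP[c0 cm].
  have mp0 : 0 < p by case: p24 => ->.
  have m0 : 0 < m%:R :> R by rewrite ltr0n (is_m_gt0 mp0 pm).
  (* The value at 0 will be 1 and the integral at most pi / m for either exponent, so it is enough
     that c (1 + (n - 1) / b) pi / m < 1. *)
  have [|b b0 bd] := @large_factor R (c * (pi / m%:R)) n.-1.
    rewrite mulr_ge0 ?divr_ge0 ?(ltW pi0) ?(ltW m0)//=.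
    by rewrite mulrA ltr_pdivrMr// mul1r -ltr_pdivlMr.
  have [f [pf poles dE sdE [f0 muf int2 int4]]] :=
    perturbed_simple_pole n.-1 (ltr01 : 0 < 1 :> R) b0.
  exists f; rewrite sdE dE prednK//; split=> //.
    by move=> z /poles[] ->; rewrite oppr_eq0 ?oner_neq0// gt_eqF.
  have intf : (\int[@lebesgue_measure R]_x (absev f x `^ p)%:E <= (pi / m%:R)%:E)%E.
    case: p24 => pE; rewrite pE in pm *.
      by rewrite (is_m2 pm).
    by rewrite (is_m4 pm); move: int4; rewrite expr1n mulr1.
  apply: (rhs_mu_lt_normL _ _ muf intf) => //.
  by rewrite f0 invr1 powR1 mulrAC.
split.
  move=> delta n m c d0 n0 m2 /andP[c0 cm].
  rewrite (is_m2 m2) ltr_pdivlMr// in cm.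
  (* For the kernel with pole at -i a, the strict inequality c n / delta * n pi / a < (n / a)^2
     amounts to c pi a < delta. *)
  have [|a ad da] := @strip_height R delta (c * pi) d0.
    by rewrite mulr_ge0// ltW.
  have a0 := lt_trans d0 ad.
  have [f [pf poles dE sdE [f0 muf intf]]] := extremal_pole_kernel a0 n0.
  exists f; rewrite sdE dE; split=> //.
    by move=> z /poles ->; rewrite normrN gtr0_norm// -ltNge.
  apply: (rhs_strip_lt_normL _ _ _ intf) => //.
  rewrite f0 dE (powR_mulrn 2) ?divr_ge0 ?(ltW a0)//.
  have -> : c * n%:R / delta * (n%:R * (pi / a)) = c * pi * a / delta * (n%:R / a) ^+ 2.
    by move: (pi : R) => k; field; rewrite !gt_eqF.
  rewrite gtr_pMl ?ltr_pdivrMr ?mul1r// exprn_gt0// divr_gt0// ltr0n//.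
move=> delta m c d0 m4 /andP[c0 cm].
rewrite (is_m4 m4) ltr_pdivlMr// in cm.
(* For 1 / (x + i a), the strict inequality c / delta * pi / (2 a^3) < a^-4 amounts to (c pi / 2) a
   < delta. *)
have [|a ad da] := @strip_height R delta (c * pi / 2) d0.
  by rewrite divr_ge0 ?mulr_ge0 ?(ltW pi0)//= ltr_pdivrMr// mul1r.
have a0 := lt_trans d0 ad.
have [f [pf poles dE sdE [f0 muf _ intf]]] := perturbed_simple_pole 0 a0 a0.
exists f; rewrite sdE dE; split=> //.
  by move=> z /poles[] ->; rewrite normrN gtr0_norm// -ltNge.
apply: (rhs_strip_lt_normL _ _ _ intf) => //.
rewrite f0 dE (powR_mulrn 4) ?invr_ge0 ?(ltW a0)//.
have -> : c * 1%:R / delta * (pi / (2 * a ^+ 3)) = c * pi / 2 * a / delta * a^-1 ^+ 4.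
  by move: (pi : R) => k; field; rewrite !gt_eqF.
by rewrite gtr_pMl ?ltr_pdivrMr ?mul1r// exprn_gt0// invr_gt0.
Qed.
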